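(* Let $W=W_{\mathsf L}W_{\mathsf R}$ be a regular Bessel type matrix of weights with $z^2W_{\mathsf L}'(z)=h^{\mathsf L}(z)W_{\mathsf L}(z)$ and $z^2W_{\mathsf R}'(z)=W_{\mathsf R}(z)h^{\mathsf R}(z)$, $h^{\mathsf L},h^{\mathsf R}$ entire matrix functions, and let $\mathsf C^{\mathsf L},\mathsf C^{\mathsf R}$ be the constant matrices with $(W_{\mathsf L})_-=(W_{\mathsf L})_+\mathsf C^{\mathsf L}$ and $(W_{\mathsf R})_-=\mathsf C^{\mathsf R}(W_{\mathsf R})_+$ on $\gamma$. Then the constant jump fundamental matrices $Z_n^{\mathsf L}$ and $Z_n^{\mathsf R}$ satisfy, for each $n\in\mathbb N$, the following properties: i) they are holomorphic on $\mathbb C\setminus\gamma$; ii) they present the following constant jump condition on $\gamma$: $$\big(Z_n^{\mathsf L}(z)\big)_+=\big(Z_n^{\mathsf L}(z)\big)_-\begin{bmatrix}\mathsf C^{\mathsf L}&\mathsf C^{\mathsf L}\\0&I\end{bmatrix},\qquad \big(Z_n^{\mathsf R}(z)\big)_+=\begin{bmatrix}I&0\\\mathsf C^{\mathsf R}&\mathsf C^{\mathsf R}\end{bmatrix}\big(Z_n^{\mathsf R}(z)\big)_-.$$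
   Context: $\mathbb N=\{0,1,2,\dots\}$; $N\ge1$ is fixed; $I$ and $0$ denote identity and zero matrices; block matrices have $N\times N$ blocks. Curve: $\gamma$ is a simple loop starting at the origin, encircling the point at infinity once in the positive direction, and then returning to the origin. $(f(z))_\pm$ are the boundary values of $f$ on $\gamma$ from the two sides, $\pm$ determined by the orientation of $\gamma$, so that the second kind functions below satisfy $(Q_n^{\mathsf L})_+-(Q_n^{\mathsf L})_-=P_n^{\mathsf L}W$ and $(Q_n^{\mathsf R})_+-(Q_n^{\mathsf R})_-=WP_n^{\mathsf R}$ on $\gamma$. Bessel type: an $N\times N$ matrix of weights $W=[W^{(j,k)}]$ with support $\gamma$ is of Bessel type if $W^{(j,k)}(z)=\sum_{m\in I_{j,k}}\varphi_m(z)z^{p_m}\log^{q_m}(z)\,e^{-\lambda_m/z}$, $z\in\gamma$, with finite index sets $I_{j,k}$, exponents $p_m$, $\Re(\lambda_m)\ge0$, $q_m\in\mathbb N$, and $\varphi_m$ Hölder continuous, bounded and nonvanishing on $\gamma$; the $\varphi_m$ are also required to have a holomorphic extension to $\mathbb C$. Regular: the moments $W_n=\int_\gamma z^nW(z)\frac{dz}{2\pi i}$ satisfy $\det[W_{j+k}]_{j,k=0,\dots,n}\ne0$ for all $n\in\mathbb N$. Factorization: $W$ satisfies the matrix Pearson type equation $z^2W'(z)=h^{\mathsf L}(z)W(z)+W(z)h^{\mathsf R}(z)$ and $W(z)=W_{\mathsf L}(z)W_{\mathsf R}(z)$, where $W_{\mathsf L},W_{\mathsf R}$ are invertible matrix solutions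 of the two differential equations in the claim; they possibly have a branch point at $0$, with $\gamma$ as branch cut, so that constant matrices $\mathsf C^{\mathsf L},\mathsf C^{\mathsf R}$ as in the claim exist. Biorthogonal polynomials: $P_n^{\mathsf L},P_n^{\mathsf R}$ are the monic $N\times N$ matrix polynomials of degree $n$ with $\int_\gamma P_n^{\mathsf L}(z)W(z)z^k\frac{dz}{2\pi i}=\delta_{n,k}C_n^{-1}$ and $\int_\gamma z^kW(z)P_n^{\mathsf R}(z)\frac{dz}{2\pi i}=\delta_{n,k}C_n^{-1}$ for $k\in\{0,\dots,n\}$, with $C_n$ nonsingular. Second kind functions: $Q_n^{\mathsf L}(z)=\int_\gamma\frac{P_n^{\mathsf L}(z')}{z'-z}W(z')\frac{dz'}{2\pi i}$, $Q_n^{\mathsf R}(z)=\int_\gamma W(z')\frac{P_n^{\mathsf R}(z')}{z'-z}\frac{dz'}{2\pi i}$. Initial conditions: $P_{-1}^{\mathsf L}=P_{-1}^{\mathsf R}=0$, $Q_{-1}^{\mathsf L}=Q_{-1}^{\mathsf R}=-C_{-1}^{-1}$. Put $$Y_n^{\mathsf L}=\begin{bmatrix}P_n^{\mathsf L}&Q_n^{\mathsf L}\\-C_{n-1}P_{n-1}^{\mathsf L}&-C_{n-1}Q_{n-1}^{\mathsf L}\end{bmatrix},\qquad Y_n^{\mathsf R}=\begin{bmatrix}P_n^{\mathsf R}&-P_{n-1}^{\mathsf R}C_{n-1}\\Q_n^{\mathsf R}&-Q_{n-1}^{\mathsf R}C_{n-1}\end{bmatrix}.$$ Constant jump fundamental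 matrices: $$Z_n^{\mathsf L}(z)=Y_n^{\mathsf L}(z)\begin{bmatrix}W_{\mathsf L}(z)&0\\0&W_{\mathsf R}^{-1}(z)\end{bmatrix},\qquad Z_n^{\mathsf R}(z)=\begin{bmatrix}W_{\mathsf R}(z)&0\\0&W_{\mathsf L}^{-1}(z)\end{bmatrix}Y_n^{\mathsf R}(z).$$
   Formalization: W_L and W_R are required to be, inside and outside the loop, branches of one multivalued solution, which forces C^L = C^R = I; for unrelated solutions on the two sides (e.g. N=1, W_L doubled inside the loop) the printed jumps are false. The endpoint 0 carries no boundary values. *)

(* Defs.v *)
From HB Require Import structures.
From mathcomp Require Import all_boot all_order all_algebra.
From mathcomp Require Import all_classical all_reals all_analysis.
From mathcomp Require Import complex.
Set Implicit Arguments.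
Unset Strict Implicit.
Unset Printing Implicit Defensive.
Import Order.TTheory GRing.Theory Num.Theory.
Import numFieldNormedType.Exports.
Local Open Scope classical_set_scope.
Local Open Scope ring_scope.
Local Open Scope complex_scope.

(* Naming R[i] as a numClosedFieldType gives it the topology and normed module
   structure that MathComp-Analysis attaches to numeric fields. *)
Definition Cx (R : realType) : numClosedFieldType := R[i].

Section Complex.
Variable R : realType.
Implicit Types (z : Cx R).

Definition mkC (a b : R) : Cx R := a +i* b.
Definition reC z : R := complex.Re (z : R[i]).
Definition imC z : R := complex.Im (z : R[i]).
Definition absC z : R := reC `|z|.

Definition cexp z : Cx R :=
  mkC (expR (reC z) * cos (imC z)) (expR (reC z) * sin (imC z)).

Definition holomorphic_on (D : set (Cx R)) (f : Cx R -> Cx R) : Prop :=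
  forall z, D z -> derivable f z 1.

Definition mx_holomorphic_on m n (D : set (Cx R))
    (F : Cx R -> 'M[Cx R]_(m, n)) : Prop :=
  forall i j, holomorphic_on D (fun z => F z i j).

Definition mx_deriv m n (F : Cx R -> 'M[Cx R]_(m, n)) z : 'M[Cx R]_(m, n) :=
  \matrix_(i, j) 'D_1 (fun w => F w i j) z.

End Complex.

Section Contour.
Variable R : realType.
Implicit Types (g : R -> Cx R) (z : Cx R).

Definition path_deriv g (t : R) : Cx R :=
  mkC (derive1 (fun u => reC (g u)) t) (derive1 (fun u => imC (g u)) t).

(* C^1 in the interior, the derivative having finite limits at the ends. *)
Definition C1_between (a b : R) (f : R -> R) : Prop :=
  exists2 f' : R -> R, {within `[a, b], continuous f'} &
    forall t, a < t < b -> is_derive t 1 f (f' t).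

Definition piecewise_C1 g : Prop :=
  exists (n : nat) (a : nat -> R),
    [/\ a 0%N = 0, a n = 1 &
      forall k, (k < n)%N ->
        [/\ a k < a k.+1,
            C1_between (a k) (a k.+1) (fun t => reC (g t)) &
            C1_between (a k) (a k.+1) (fun t => imC (g t))]].

Definition loop_set g : set (Cx R) := g @` `[0, 1].

Definition contour_integrable g (f : Cx R -> Cx R) : Prop :=
  lebesgue_measure.-integrable `[0, 1]
    (fun t : R => (reC (f (g t) * path_deriv g t))%:E) /\
  lebesgue_measure.-integrable `[0, 1]
    (fun t : R => (imC (f (g t) * path_deriv g t))%:E).

(* integral of f along g against dz / (2 pi i) *)
Definition contour_int g (f : Cx R -> Cx R) : Cx R :=
  mkC (\int[lebesgue_measure]_(t in `[0, 1]) reC (f (g t) * path_deriv g t))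
      (\int[lebesgue_measure]_(t in `[0, 1]) imC (f (g t) * path_deriv g t))
  / mkC 0 (2 * pi).

Definition mx_contour_int m n g (F : Cx R -> 'M[Cx R]_(m, n)) :
    'M[Cx R]_(m, n) :=
  \matrix_(i, j) contour_int g (fun z => F z i j).

Definition winding g z : Cx R := contour_int g (fun w => (w - z)^-1).

(* Winding once positively around the point at infinity of the Riemann sphere
   is winding once negatively around the points of the bounded component of
   the complement of the loop; those of the unbounded component always have
   winding number 0. *)
Definition loop_around_infinity g : Prop :=
  [/\ {within `[0, 1], continuous g},
      piecewise_C1 g,
      g 0 = 0 /\ g 1 = 0,
      {in `[0, 1[ &, injective g} &
      exists2 z, ~ loop_set g z & winding g z = -1].

(* The + side of a loop as above is the side on its left, i.e. the unbounded
   component of the complement (the one that contains infinity); the - side is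
   the bounded one.  The winding number is larger by one on the left, which is
   the orientation for which Cauchy integrals satisfy f_+ - f_- = density. *)
Definition plus_side g : set (Cx R) :=
  [set z | ~ loop_set g z /\ winding g z = 0].
Definition minus_side g : set (Cx R) :=
  [set z | ~ loop_set g z /\ winding g z = -1].

(* A is the boundary value at z of F from the given side *)
Definition bdry_plus m n g (F : Cx R -> 'M[Cx R]_(m, n)) z
    (A : 'M[Cx R]_(m, n)) : Prop :=
  F @ within (plus_side g) (nbhs z) --> A.
Definition bdry_minus m n g (F : Cx R -> 'M[Cx R]_(m, n)) z
    (A : 'M[Cx R]_(m, n)) : Prop :=
  F @ within (minus_side g) (nbhs z) --> A.

(* The endpoint 0 of the loop, where z^p, log z and exp (- lambda / z) are not
   defined, carries no boundary values. *)
Definition jump_set g : set (Cx R) := loop_set g `\ (0 : Cx R).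

End Contour.

Section Weights.
Variables (R : realType) (N : nat).
Implicit Types (g : R -> Cx R) (W : Cx R -> 'M[Cx R]_N).

Definition holder_on (D : set (Cx R)) (f : Cx R -> Cx R) : Prop :=
  exists K alpha : R, 0 < alpha <= 1 /\
    forall z w, D z -> D w -> absC (f z - f w) <= K * (absC (z - w) `^ alpha).

Definition bessel_coefficient g (phi : Cx R -> Cx R) : Prop :=
  [/\ holder_on (loop_set g) phi,
      exists M : R, forall z, loop_set g z -> absC (phi z) <= M,
      forall z, loop_set g z -> phi z != 0 &
      holomorphic_on setT phi].

(* ell is the determination of the logarithm along the loop that gives a
   meaning to z^p = exp (p log z) and to log z. *)
Definition bessel_type g W : Prop :=
  exists ell : R -> Cx R,
    (forall t, 0 < t < 1 -> {for t, continuous ell} /\ cexp (ell t) = g t) /\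
    forall i j, exists (r : nat) (phi : 'I_r -> Cx R -> Cx R)
        (p lambda : 'I_r -> Cx R) (q : 'I_r -> nat),
      (forall m, bessel_coefficient g (phi m) /\ 0 <= reC (lambda m)) /\
      forall t, 0 < t < 1 ->
        W (g t) i j = \sum_(m < r) phi m (g t) * cexp (p m * ell t)
                        * ell t ^+ q m * cexp (- lambda m / g t).

Definition moments_exist g W : Prop :=
  forall (n : nat) i j, contour_integrable g (fun z => z ^+ n * W z i j).

Definition moment g W (n : nat) : 'M[Cx R]_N :=
  mx_contour_int g (fun z => z ^+ n *: W z).

Definition regular g W : Prop :=
  forall n : nat,
    \det (\mxblock_(j < n.+1, k < n.+1) moment g W (j + k)%N) != 0.

End Weights.

Section Pearson.
Variables (R : realType) (N : nat).
Implicit Types (g : R -> Cx R) (h W WL WR F : Cx R -> 'M[Cx R]_N).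

(* A multivalued function on C \ {0} with branch point 0 is encoded by an
   entire function F of s = log z; its determinations at z are the F s with
   exp s = z.  Since F (s) = W (exp s) gives F' (s) = z W' (z), the equation
   z^2 W' = h W reads  exp s F' (s) = h (exp s) F s. *)
Definition multivalued_left_solution h F : Prop :=
  mx_holomorphic_on setT F /\
  forall s, F s \in unitmx /\ cexp s *: mx_deriv F s = h (cexp s) *m F s.

Definition multivalued_right_solution h F : Prop :=
  mx_holomorphic_on setT F /\
  forall s, F s \in unitmx /\ cexp s *: mx_deriv F s = F s *m h (cexp s).

(* W is, on D, a single-valued choice of determinations of F: locally at each
   point of D, W is one of the germs of F. *)
Definition branch_on (D : set (Cx R)) F W : Prop :=
  forall z, D z -> exists s, cexp s = z /\
    \forall u \near s, W (cexp u) = F u.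

(* Invertible solutions of the equation off the loop, which is used as branch
   cut: W is a branch, off the loop, of one multivalued solution.  The values
   on the two sides of the loop are thus determinations of the same analytic
   function, not unrelated solutions.  Pitfall: the complement of the loop
   contains a punctured neighbourhood of infinity, on which W is single valued,
   so F has period 2 pi i and the two boundary values of W agree. *)
Definition left_solution g h W : Prop :=
  [/\ mx_holomorphic_on (~` loop_set g) W,
      forall z, ~ loop_set g z -> W z \in unitmx,
      forall z, ~ loop_set g z -> z ^+ 2 *: mx_deriv W z = h z *m W z &
      exists2 F, multivalued_left_solution h F &
                 branch_on (~` loop_set g) F W].

Definition right_solution g h W : Prop :=
  [/\ mx_holomorphic_on (~` loop_set g) W,
      forall z, ~ loop_set g z -> W z \in unitmx,
      forall z, ~ loop_set g z -> z ^+ 2 *: mx_deriv W z = W z *m h z &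
      exists2 F, multivalued_right_solution h F &
                 branch_on (~` loop_set g) F W].

(* W = W_L W_R on the loop, the factors being taken on the + side of the cut *)
Definition factorizes g W WL WR : Prop :=
  forall z, jump_set g z -> forall A B,
    bdry_plus g WL z A -> bdry_plus g WR z B -> W z = A *m B.

End Pearson.

Section Biorthogonal.
Variables (R : realType) (N : nat).
Implicit Types (g : R -> Cx R) (W WL WR : Cx R -> 'M[Cx R]_N) (z : Cx R).
Implicit Types (P : nat -> 'M[{poly Cx R}]_N) (C : nat -> 'M[Cx R]_N).

Definition mxeval (p : 'M[{poly Cx R}]_N) z : 'M[Cx R]_N :=
  map_mx (fun q : {poly Cx R} => q.[z]) p.

Definition mx_monic (n : nat) (p : 'M[{poly Cx R}]_N) : Prop :=
  (forall i j, (size (p i j) <= n.+1)%N) /\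
  (\matrix_(i, j) (p i j)`_n = 1%:M :> 'M[Cx R]_N).

Definition left_orthogonal g W C P : Prop :=
  forall n, mx_monic n (P n) /\
    forall k, (k <= n)%N ->
      mx_contour_int g (fun z => z ^+ k *: (mxeval (P n) z *m W z))
      = (n == k)%:R *: invmx (C n).

Definition right_orthogonal g W C P : Prop :=
  forall n, mx_monic n (P n) /\
    forall k, (k <= n)%N ->
      mx_contour_int g (fun z => z ^+ k *: (W z *m mxeval (P n) z))
      = (n == k)%:R *: invmx (C n).

Definition QL g W P (n : nat) z : 'M[Cx R]_N :=
  mx_contour_int g (fun w => (w - z)^-1 *: (mxeval (P n) w *m W w)).

Definition QR g W P (n : nat) z : 'M[Cx R]_N :=
  mx_contour_int g (fun w => (w - z)^-1 *: (W w *m mxeval (P n) w)).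

(* u_(n-1), where u_(-1) = x *)
Definition prev (T : Type) (x : T) (u : nat -> T) (n : nat) : T :=
  if n is m.+1 then u m else x.

(* Cm1 is C_(-1); P_(-1) = 0 and Q_(-1) = - C_(-1)^-1. *)
Definition YL g W C (Cm1 : 'M[Cx R]_N) P (n : nat) z : 'M[Cx R]_(N + N) :=
  block_mx
    (mxeval (P n) z) (QL g W P n z)
    (- (prev Cm1 C n *m prev 0 (fun m => mxeval (P m) z) n))
    (- (prev Cm1 C n *m prev (- invmx Cm1) (fun m => QL g W P m z) n)).

Definition YR g W C (Cm1 : 'M[Cx R]_N) P (n : nat) z : 'M[Cx R]_(N + N) :=
  block_mx
    (mxeval (P n) z) (- (prev 0 (fun m => mxeval (P m) z) n *m prev Cm1 C n))
    (QR g W P n z)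
    (- (prev (- invmx Cm1) (fun m => QR g W P m z) n *m prev Cm1 C n)).

Definition ZL g W WL WR C Cm1 P (n : nat) z : 'M[Cx R]_(N + N) :=
  YL g W C Cm1 P n z *m block_mx (WL z) 0 0 (invmx (WR z)).

Definition ZR g W WL WR C Cm1 P (n : nat) z : 'M[Cx R]_(N + N) :=
  block_mx (WR z) 0 0 (invmx (WL z)) *m YR g W C Cm1 P n z.

End Biorthogonal.

(* Main.v *)
Require Import Defs.
From HB Require Import structures.
From mathcomp Require Import all_boot all_order all_algebra.
From mathcomp Require Import all_classical all_reals all_analysis.
From mathcomp Require Import complex measurable_realfun ring lra.
Set Implicit Arguments.
Unset Strict Implicit.
Unset Printing Implicit Defensive.
Import Order.TTheory GRing.Theory Num.Theory.
Import numFieldNormedType.Exports.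
Local Open Scope classical_set_scope.
Local Open Scope ring_scope.

(** A multivalued solution F of the equation of W_L is an entire function of
   s = log z.  On a half-plane [Re s > x0], whose image under exp lies outside
   the loop, W_L (exp s) solves the same linear equation and agrees with F, so
   F takes equal values at s and s + T whenever exp T = 1, first there and then
   everywhere.  Hence W_L and W_R are restrictions of functions E_L and E_R
   defined and locally Lipschitz on the punctured plane; on the loop their two
   boundary values agree, C^L = C^R = I, and W = E_L E_R.

   For the second kind functions, if f is the restriction to the loop of a
   function G that is Lipschitz near z0, the Cauchy integral of f at z is
   G(z) times the winding number at z plus the integral of
   (f(w) - G(z)) / (w - z), which converges as z -> z0 by dominated convergence.
   The jump G(z0) comes from the winding number alone, so that neither the
   Jordan curve theorem nor any smoothness of the loop at z0 is needed. *)

(** * Complex numbers as pairs of reals *)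

(** The variable [s = log z] is there for convexity. The exterior of a disc is not convex, but the
    half-plane above it is, and on a convex set a zero derivative forces constancy by the real mean
    value theorem. Regularity is obtained in the same elementary spirit: the equation expresses F'
    through h and F, so F' is continuous without Cauchy's theorem, and a Lipschitz local inverse of
    exp carries the resulting bound from F to E.

    The jump argument subtracts G(z) and not G(z0). Since z may approach the loop tangentially, |w -
    z0| is not controlled by |w - z|, and (f(w) - G(z0)) / (w - z) has no uniform bound; with G(z)
    the Lipschitz constant bounds the quotient however z arrives. This is why G must be defined off
    the loop too, and why E is built before Q is treated.

    With W_L and W_R continuous across the loop, the whole jump of Z comes from Q: its jump P W_L
    W_R meets the factor W_R^-1 and becomes P W_L, which is the neighbouring block. The right-hand
    case is the mirror image. *)

Section ComplexBasics.
Variable R : realType.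
Implicit Types (z w : Cx R) (e : R).

Lemma reCD z w : reC (z + w) = reC z + reC w. Proof. by case: z w => ? ? []. Qed.
Lemma imCD z w : imC (z + w) = imC z + imC w. Proof. by case: z w => ? ? []. Qed.
Lemma reCN z : reC (- z) = - reC z. Proof. by case: z. Qed.
Lemma imCN z : imC (- z) = - imC z. Proof. by case: z. Qed.
Lemma reCB z w : reC (z - w) = reC z - reC w. Proof. by rewrite reCD reCN. Qed.
Lemma imCB z w : imC (z - w) = imC z - imC w. Proof. by rewrite imCD imCN. Qed.
Lemma reCM z w : reC (z * w) = reC z * reC w - imC z * imC w.
Proof. by case: z w => ? ? []. Qed.
Lemma imCM z w : imC (z * w) = reC z * imC w + imC z * reC w.
Proof. by case: z w => ? ? []. Qed.

Lemma Cx_eqP z w : reC z = reC w -> imC z = imC w -> z = w.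
Proof. by case: z w => ? ? [] ? ? /= -> ->. Qed.

Lemma mkCE z : z = mkC (reC z) (imC z). Proof. by case: z. Qed.

Lemma absCE z : absC z = Num.sqrt (reC z ^+ 2 + imC z ^+ 2).
Proof. by rewrite /absC; case: z. Qed.

Lemma normCE z : `|z| = mkC (absC z) 0.
Proof. by rewrite /absC; case: z. Qed.

Lemma absC_ge0 z : 0 <= absC z. Proof. by rewrite absCE sqrtr_ge0. Qed.

Lemma mkC0D (a b : R) : mkC a 0 + mkC b 0 = mkC (a + b) 0 :> Cx R.
Proof. by apply: Cx_eqP; rewrite ?reCD ?imCD //= addr0. Qed.

Lemma mkC0M (a b : R) : mkC a 0 * mkC b 0 = mkC (a * b) 0 :> Cx R.
Proof. by apply: Cx_eqP; rewrite ?reCM ?imCM /reC /imC /=; ring. Qed.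

Lemma ltC_mk (a b : R) : (mkC a 0 < mkC b 0 :> Cx R) = (a < b).
Proof. by rewrite ltcE /= eqxx. Qed.

Lemma leC_mk (a b : R) : (mkC a 0 <= mkC b 0 :> Cx R) = (a <= b).
Proof. by rewrite lecE /= eqxx. Qed.

Lemma absCD z w : absC (z + w) <= absC z + absC w.
Proof. by rewrite -leC_mk -mkC0D -!normCE ler_normD. Qed.

Lemma absCM z w : absC (z * w) = absC z * absC w.
Proof.
by have := normrM z w; rewrite !normCE mkC0M => /(congr1 (@reC R)).
Qed.

Lemma absCN z : absC (- z) = absC z.
Proof. by rewrite /absC normrN. Qed.

Lemma absCB z w : absC (z - w) = absC (w - z).
Proof. by rewrite -absCN opprB. Qed.

Lemma absC0 : absC (0 : Cx R) = 0. Proof. by rewrite /absC normr0. Qed.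
Lemma absC1 : absC (1 : Cx R) = 1. Proof. by rewrite /absC normr1. Qed.

Lemma absC_eq0 z : (absC z == 0) = (z == 0).
Proof.
apply/eqP/eqP => [h|->]; last exact: absC0.
by apply/normr0_eq0; rewrite normCE h.
Qed.

Lemma absC_gt0 z : (0 < absC z) = (z != 0).
Proof. by rewrite lt_def absC_ge0 andbT absC_eq0. Qed.

Lemma absCV z : absC z^-1 = (absC z)^-1.
Proof.
have [->|z0] := eqVneq z 0; first by rewrite invr0 absC0 invr0.
have a0 : absC z != 0 by rewrite absC_eq0.
by apply: (mulfI a0); rewrite -absCM !divff // absC1.
Qed.

Lemma absCX z n : absC (z ^+ n) = absC z ^+ n.
Proof. by elim: n => [|n IH]; rewrite ?expr0 ?absC1 // !exprS absCM IH. Qed.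

Lemma absC_mk a : absC (mkC a 0) = `|a| :> R.
Proof. by rewrite absCE /reC /imC /= expr0n addr0 sqrtr_sqr. Qed.

Lemma reC_le z : `|reC z| <= absC z.
Proof. by rewrite absCE -sqrtr_sqr ler_wsqrtr // lerDl sqr_ge0. Qed.

Lemma imC_le z : `|imC z| <= absC z.
Proof. by rewrite absCE -sqrtr_sqr ler_wsqrtr // lerDr sqr_ge0. Qed.

Lemma absC_le z : absC z <= `|reC z| + `|imC z|.
Proof.
rewrite absCE -[leRHS]ger0_norm ?addr_ge0 // -sqrtr_sqr ler_wsqrtr // sqrrD.
by rewrite !real_normK ?num_real // lerD2r lerDl mulrn_wge0 // mulr_ge0.
Qed.

Lemma absCB_ge z w : absC z - absC w <= absC (z - w).
Proof. by rewrite lerBlDr; apply: le_trans (absCD _ _); rewrite subrK. Qed.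

(** Radii of balls in [Cx R] are themselves complex numbers. A complex number that is positive for
    the order has zero imaginary part, so real radii suffice. *)
Lemma cvg_absCP T (F : set_system T) (FF : Filter F) (f : T -> Cx R) (l : Cx R) :
  f @ F --> l <->
  forall e, 0 < e -> \forall x \near F, absC (f x - l) < e.
Proof.
split.
  move/cvgrPdist_lt => fl e e0.
  have /fl : (0 : Cx R) < mkC e 0 by rewrite ltC_mk.
  by apply: filterS => x; rewrite distrC normCE ltC_mk.
move=> fl; apply/cvgrPdist_lt => e e0.
have [eim ere] : imC e = 0 /\ 0 < reC e.
  by move: e0; rewrite ltcE /imC /reC /= => /andP[/eqP -> ->].
have -> : e = mkC (reC e) 0 by rewrite [LHS]mkCE eim.
by apply: filterS (fl _ ere) => x; rewrite distrC normCE ltC_mk.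
Qed.

Lemma nbhs_absCP z (A : set (Cx R)) :
  nbhs z A <-> exists2 e, 0 < e & forall w, absC (w - z) < e -> A w.
Proof.
split.
  move/nbhs_ballP => [e /= e0 sA].
  have [eim ere] : imC e = 0 /\ 0 < reC e.
    by move: e0; rewrite ltcE /imC /reC /= => /andP[/eqP -> ->].
  exists (reC e) => // w hw; apply: sA; rewrite -ball_normE /ball_ /=.
  by rewrite distrC normCE [ltRHS]mkCE eim ltC_mk.
move=> [e e0 sA]; apply/nbhs_ballP; exists (mkC e 0); first by rewrite /= ltC_mk.
by move=> w; rewrite -ball_normE /ball_ /= distrC normCE ltC_mk; apply: sA.
Qed.

Lemma near_absC z e : 0 < e -> \forall w \near z, absC (w - z) < e.
Proof. by move=> e0; apply/nbhs_absCP; exists e. Qed.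

Lemma cvg_mxP T (F : set_system T) (FF : Filter F) m n
    (f : T -> 'M[Cx R]_(m, n)) (A : 'M[Cx R]_(m, n)) :
  f @ F --> A <-> forall i j, (fun x => f x i j) @ F --> A i j.
Proof.
split.
  move=> fA i j P PA; have := fA [set M | P (M i j)]; apply.
  (* A neighbourhood of a matrix is given by one neighbourhood per entry: this family constrains the
     entry (i, j) only. *)
  exists (fun i' j' => [set a | i' = i -> j' = j -> P a]) => [i' j'|M /=].
    have [ei|ni] := eqVneq i' i; last first.
      by apply: filterS filterT => a _ e; rewrite e eqxx in ni.
    have [ej|nj] := eqVneq j' j; last first.
      by apply: filterS filterT => a _ _ e; rewrite e eqxx in nj.
    by rewrite ei ej; apply: filterS PA => a ? _ _.
  by apply.
move=> fA B [P PA sPB].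
have : \forall x \near F, forall k : 'I_m * 'I_n, P k.1 k.2 (f x k.1 k.2).
  by apply: filter_forall => -[i j]; apply: fA (PA i j).
by apply: filterS => x Px; apply: sPB => i j; apply: Px (i, j).
Qed.

End ComplexBasics.

(** * Complex derivatives and the mean value inequality *)

Section PointwiseRules.
Variable R : realType.
Implicit Types (z : Cx R) (f g : Cx R -> Cx R).

Lemma is_derive_add f g z (df dg : Cx R) : is_derive z 1 f df -> is_derive z 1 g dg ->
  is_derive z 1 (fun w => f w + g w) (df + dg).
Proof. by move=> fD gD; have := is_deriveD fD gD. Qed.

Lemma is_derive_opp f z (df : Cx R) : is_derive z 1 f df ->
  is_derive z 1 (fun w => - f w) (- df).
Proof. by move=> fD; have := is_deriveN fD. Qed.

Lemma is_derive_mul f g z (df dg : Cx R) : is_derive z 1 f df -> is_derive z 1 g dg ->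
  is_derive z 1 (fun w => f w * g w) (df * g z + f z * dg).
Proof.
move=> fD gD; have := is_deriveM fD gD.
by rewrite addrC; congr (is_derive _ _ _ (_ + _)); rewrite mulrC.
Qed.

Lemma is_derive_const (c z : Cx R) : is_derive z 1 (fun=> c) 0.
Proof. by have := is_derive_cst c z (1 : Cx R). Qed.

Lemma is_derive_ident (z : Cx R) : is_derive z 1 (fun w : Cx R => w) 1.
Proof. by have := is_derive_id z (1 : Cx R). Qed.

Lemma derivable_is_derive f z : derivable f z 1 -> is_derive z 1 f ('D_1 f z).
Proof. by move=> fD; have := derivableP fD. Qed.

Lemma is_derive_derivable f z (df : Cx R) : is_derive z 1 f df -> derivable f z 1.
Proof. by case. Qed.

Lemma derivable_add f g z : derivable f z 1 -> derivable g z 1 ->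
  derivable (fun w => f w + g w) z 1.
Proof.
move=> /derivable_is_derive fD /derivable_is_derive gD.
exact: is_derive_derivable (is_derive_add fD gD).
Qed.

Lemma derivable_neg f z : derivable f z 1 -> derivable (fun w => - f w) z 1.
Proof.
by move=> /derivable_is_derive fD; exact: is_derive_derivable (is_derive_opp fD).
Qed.

Lemma derivable_mul f g z : derivable f z 1 -> derivable g z 1 ->
  derivable (fun w => f w * g w) z 1.
Proof.
move=> /derivable_is_derive fD /derivable_is_derive gD.
exact: is_derive_derivable (is_derive_mul fD gD).
Qed.

Lemma derivable_inv f z : f z != 0 -> derivable f z 1 ->
  derivable (fun w => (f w)^-1) z 1.
Proof. by move=> f0 fD; have := derivableV f0 fD. Qed.

Lemma derivable_const (c z : Cx R) : derivable (fun=> c) z 1.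
Proof. by case: (is_derive_const c z). Qed.

Lemma is_derive_bigsum (I : Type) (r : seq I) (P : pred I) (f : I -> Cx R -> Cx R)
    (df : I -> Cx R) z :
  (forall i, is_derive z 1 (f i) (df i)) ->
  is_derive z 1 (fun w => \sum_(i <- r | P i) f i w) (\sum_(i <- r | P i) df i).
Proof.
move=> fD; elim: r => [|i r IH].
  under eq_fun do rewrite big_nil; rewrite big_nil; exact: is_derive_const.
under eq_fun do rewrite big_cons; rewrite big_cons.
case: (P i); last exact: IH.
exact: is_derive_add (fD i) IH.
Qed.

Lemma derivable_bigsum (I : Type) (r : seq I) (P : pred I) (f : I -> Cx R -> Cx R) z :
  (forall i, derivable (f i) z 1) ->
  derivable (fun w => \sum_(i <- r | P i) f i w) z 1.
Proof.
move=> fD.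
exact: is_derive_derivable (is_derive_bigsum r P (fun i => derivable_is_derive (fD i))).
Qed.

Lemma derivable_bigprod (I : Type) (r : seq I) (P : pred I) (f : I -> Cx R -> Cx R) z :
  (forall i, derivable (f i) z 1) ->
  derivable (fun w => \prod_(i <- r | P i) f i w) z 1.
Proof.
move=> fD; elim: r => [|i r IH].
  under eq_fun do rewrite big_nil; exact: derivable_const.
under eq_fun do rewrite big_cons.
case: (P i); last exact: IH.
exact: derivable_mul (fD i) IH.
Qed.

End PointwiseRules.

Section ComplexDerivative.
Variable R : realType.
Implicit Types (z w h : Cx R) (e : R) (f : Cx R -> Cx R).

(** The little-o form has no division: at [h = 0] both sides vanish, so the punctured neighbourhood
    of the difference quotient becomes a full one. *)
Lemma is_derive_absCP f z (df : Cx R) :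
  is_derive z 1 f df <->
  forall e, 0 < e -> \forall h \near (0 : Cx R),
    absC (f (z + h) - f z - df * h) <= e * absC h.
Proof.
pose q h := h^-1 *: ((f \o shift z) (h *: (1 : Cx R)) - f z).
have qE h : h != 0 -> q h - df = h^-1 * (f (z + h) - f z - df * h).
  move=> h0; rewrite /q /shift /= addrC [h *: 1]mulr1 [h + z]addrC.
  by rewrite mulrBr (mulrC df) mulKf // addrC.
have qcvg : q h @[h --> 0^'] --> df <-> is_derive z 1 f df.
  split; last by case=> ex <-; apply: ex.
  move=> qc; split; first by apply: (cvgP df).
  exact: (cvg_lim _ qc).
rewrite -qcvg (cvg_absCP _ q); split=> H e e0.
  have := H _ e0; rewrite !near_withinE; apply: filterS => h hh.
  have [->|h0] := eqVneq h 0; first by rewrite addr0 subrr mulr0 subrr !absC0 mulr0.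
  have := hh h0; rewrite qE // absCM absCV.
  by rewrite mulrC ltr_pdivrMr ?absC_gt0 // => /ltW.
have e20 : 0 < e / 2 by rewrite divr_gt0.
rewrite near_withinE; apply: filterS (H _ e20) => h hh h0.
rewrite qE // absCM absCV mulrC ltr_pdivrMr ?absC_gt0 //.
apply: le_lt_trans hh _; rewrite ltr_pM2r ?absC_gt0 //; lra.
Qed.

Lemma is_deriveR_absP (f : R -> R) (t df : R) :
  is_derive t (1:R) f df <->
  (forall e, 0 < e -> \forall h \near (0 : R),
    `|f (t + h) - f t - df * h| <= e * `|h|).
Proof.
pose q (h : R) := h^-1 *: ((f \o shift t) (h *: (1 : R)) - f t).
have qE (h : R) : h != 0 -> q h - df = h^-1 * (f (t + h) - f t - df * h).
  move=> h0; rewrite /q /shift /= addrC [h *: 1]mulr1 [h + t]addrC.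
  by rewrite mulrBr (mulrC df) mulKf // addrC.
have qcvg : q h @[h --> 0^'] --> df <-> is_derive t (1 : R) f df.
  split; last by case=> ex <-; apply: ex.
  move=> qc; split; first by apply: (cvgP df).
  exact: (cvg_lim _ qc).
rewrite -qcvg; split=> [/cvgrPdist_lt H e e0|H].
  have := H _ e0; rewrite near_withinE; apply: filterS => h hh.
  have [->|h0] := eqVneq h 0; first by rewrite addr0 subrr mulr0 subrr !normr0 mulr0.
  have := hh h0; rewrite distrC qE // normrM normfV.
  by rewrite mulrC ltr_pdivrMr ?normr_gt0 // => /ltW.
apply/cvgrPdist_lt => e e0; rewrite near_withinE.
have e20 : 0 < e / 2 by rewrite divr_gt0.
apply: filterS (H _ e20) => h hh h0.
rewrite distrC qE // normrM normfV mulrC ltr_pdivrMr ?normr_gt0 //.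
apply: le_lt_trans hh _; rewrite ltr_pM2r ?normr_gt0 //; lra.
Qed.

Lemma near0_scale (P : set (Cx R)) (v : Cx R) :
  (\forall h \near (0 : Cx R), P h) -> \forall s \near (0 : R), P (mkC s 0 * v).
Proof.
move=> /nbhs_absCP [d d0 dP].
(* The summand 1 keeps the radius meaningful when [v = 0]. *)
apply/nbhs_ballP; exists (d / (1 + absC v)) => [|s].
  by rewrite /= divr_gt0 // ltr_wpDr ?absC_ge0.
rewrite -ball_normE /= sub0r normrN ltr_pdivlMr ?ltr_wpDr ?absC_ge0 // => sd.
apply: dP; rewrite subr0 absCM absC_mk; apply: le_lt_trans sd.
by rewrite ler_wpM2l // lerDr.
Qed.

(* [k = 1] and [k = -i] extract the real and imaginary parts. *)
Lemma is_derive_line f (a v k df : Cx R) (t : R) :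
  is_derive (a + mkC t 0 * v) 1 f df ->
  is_derive t (1 : R) (fun s : R => reC (k * f (a + mkC s 0 * v))) (reC (k * (df * v))).
Proof.
move=> /is_derive_absCP H; apply/is_deriveR_absP => e e0.
have pos : 0 < 1 + absC k * absC v by rewrite ltr_pwDl // mulr_ge0 ?absC_ge0.
have e1 : 0 < e / (1 + absC k * absC v) by rewrite divr_gt0.
apply: filterS (near0_scale v (H _ e1)) => s hs.
set x := a + mkC t 0 * v.
have xs : a + mkC (t + s) 0 * v = x + mkC s 0 * v.
  by rewrite -mkC0D mulrDl addrA.
rewrite xs -reCB -mulrBr.
have -> : reC (k * (df * v)) * s = reC (k * (df * (mkC s 0 * v))).
  by rewrite !(reCM, imCM) /reC /imC /=; ring.
rewrite -reCB -mulrBr; apply: le_trans (reC_le _) _; rewrite absCM.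
apply: (le_trans (ler_wpM2l (absC_ge0 k) hs)).
rewrite absCM absC_mk.
rewrite [leLHS](_ : _ = (absC k * absC v) / (1 + absC k * absC v) * (e * `|s|)); last by ring.
by rewrite ler_piMl ?mulr_ge0 ?(ltW e0) // ler_pdivrMr // mul1r lerDr.
Qed.

Definition convexC (D : set (Cx R)) :=
  forall a b (t : R), D a -> D b -> 0 <= t <= 1 -> D (a + mkC t 0 * (b - a)).

(** The real mean value theorem on [0, 1], applied to a real part of f along the segment from a to
    b, which convexity keeps inside D. *)
Lemma mean_value_part (D : set (Cx R)) f (df : Cx R -> Cx R) (M : R) (k : Cx R) a b :
  convexC D -> (forall z, D z -> is_derive z 1 f (df z)) ->
  (forall z, D z -> absC (df z) <= M) -> D a -> D b ->
  `|reC (k * (f b - f a))| <= absC k * M * absC (b - a).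
Proof.
move=> cD Df dfM Da Db.
pose F (s : R) := reC (k * f (a + mkC s 0 * (b - a))).
pose dF (s : R) := reC (k * (df (a + mkC s 0 * (b - a)) * (b - a))).
have FD (s : R) : 0 <= s <= 1 -> is_derive s (1 : R) F (dF s).
  by move=> s01; apply: is_derive_line; apply: Df; apply: cD.
have [c c01 Fc] : exists2 c, c \in `[0, 1]%R & F 1 - F 0 = dF c * (1 - 0).
  apply: MVT_segment => //.
    by move=> x; rewrite in_itv /= => /andP[x0 x1]; apply: FD; rewrite !ltW.
  apply: derivable_within_continuous => x; rewrite in_itv /= => x01.
  by have [] := FD x x01.
rewrite in_itv /= in c01.
have m1 : mkC 1 0 = 1 :> Cx R by [].
have m0 : mkC 0 0 = 0 :> Cx R by [].
have bE : a + (b - a) = b by rewrite addrC subrK.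
move: Fc; rewrite /F m1 m0 mul0r mul1r addr0 bE subr0 mulr1 -reCB -mulrBr => ->.
apply: le_trans (reC_le _) _; rewrite !absCM mulrA ler_wpM2r ?absC_ge0 //.
by rewrite ler_wpM2l ?absC_ge0 // dfM //; apply: cD.
Qed.

(** The mean value theorem fails for complex values, so real and imaginary parts are estimated
    separately, with multipliers 1 and -i; this costs the factor 2. *)
Lemma mean_value_absC (D : set (Cx R)) f (df : Cx R -> Cx R) (M : R) a b :
  convexC D -> (forall z, D z -> is_derive z 1 f (df z)) ->
  (forall z, D z -> absC (df z) <= M) -> D a -> D b ->
  absC (f b - f a) <= 2 * M * absC (b - a).
Proof.
move=> cD Df dfM Da Db.
have := mean_value_part 1 cD Df dfM Da Db.
have := mean_value_part (mkC 0 (-1)) cD Df dfM Da Db.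
rewrite absC1 !mul1r (_ : absC (mkC 0 (-1)) = 1); last first.
  by rewrite absCE /reC /imC /= expr0n add0r sqrrN expr1n sqrtr1.
rewrite mul1r (_ : reC (mkC 0 (-1) * (f b - f a)) = imC (f b - f a)); last first.
  by rewrite reCM /reC /imC /=; ring.
have := absC_le (f b - f a); lra.
Qed.

Lemma derive0_convex_const (D : set (Cx R)) f a b :
  convexC D -> (forall z, D z -> is_derive z 1 f 0) -> D a -> D b -> f a = f b.
Proof.
move=> cD Df Da Db.
have : absC (f b - f a) <= 2 * 0 * absC (b - a).
  by apply: mean_value_absC cD Df _ Da Db => z _; rewrite absC0.
rewrite mulr0 mul0r => h; apply/esym/eqP; rewrite -subr_eq0 -absC_eq0.
by rewrite eq_le h absC_ge0.
Qed.

Lemma convexC_ball z0 (r : R) : convexC [set z | absC (z - z0) < r].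
Proof.
move=> a b t /= ha hb /andP[t0 t1].
have -> : a + mkC t 0 * (b - a) - z0
    = mkC (1 - t) 0 * (a - z0) + mkC t 0 * (b - z0).
  have -> : mkC (1 - t) 0 = 1 - mkC t 0 :> Cx R.
    by apply: Cx_eqP; rewrite ?reCB ?imCB /reC /imC /= ?subr0.
  ring.
apply: le_lt_trans (absCD _ _) _; rewrite !absCM !absC_mk.
rewrite (ger0_norm t0) ger0_norm ?subr_ge0 //.
(* The strict inequality is drawn from the b-term, which vanishes at [t = 0]. *)
have [->|t0'] := eqVneq t 0; first by rewrite subr0 mul1r mul0r addr0.
have tp : 0 < t by rewrite lt_def t0'.
have : t * absC (b - z0) < t * r by rewrite ltr_pM2l.
have : (1 - t) * absC (a - z0) <= (1 - t) * r by rewrite ler_wpM2l ?subr_ge0 // ltW.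
lra.
Qed.

Lemma convexC_half (x0 : R) : convexC [set z | x0 < reC z].
Proof.
move=> a b t /= ha hb /andP[t0 t1].
rewrite reCD reCM reCB /= mul0r subr0.
(* One of the weights t and 1 - t is at least 1/2; the term carrying it is strictly positive. *)
have [t12|t12] := leP t (1 / 2).
  have : 0 <= t * (reC b - x0) by rewrite mulr_ge0 // subr_ge0 ltW.
  have : 0 < (1 - t) * (reC a - x0) by rewrite mulr_gt0 ?subr_gt0 //; lra.
  lra.
have : 0 < t * (reC b - x0) by rewrite mulr_gt0 ?subr_gt0 //; lra.
have : 0 <= (1 - t) * (reC a - x0) by rewrite mulr_ge0 ?subr_ge0 // ltW.
lra.
Qed.

Lemma convexC_setT : convexC setT. Proof. by []. Qed.

Lemma derivable_cvg f z : derivable f z 1 -> f w @[w --> z] --> f z.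
Proof.
by move=> /derivable1_diffP /differentiable_continuous.
Qed.

Lemma is_derive_comp f g z (df dg : Cx R) :
  is_derive z 1 g dg -> is_derive (g z) 1 f df ->
  is_derive z 1 (fun w => f (g w)) (df * dg).
Proof.
move=> /is_derive_absCP gD /is_derive_absCP fD; apply/is_derive_absCP => e e0.
(* K bounds the growth of the increment of g (its error is at most [absC h]), L bounds [absC df].
   Both are positive thanks to the 1, so that e can be split into two halves divided by them. *)
pose K := absC dg + 1; pose L := absC df + 1.
have K0 : 0 < K by rewrite ltr_wpDl ?absC_ge0.
have L0 : 0 < L by rewrite ltr_wpDl ?absC_ge0.
have e1 : 0 < e / 2 / K by rewrite !divr_gt0.
have e2 : 0 < e / 2 / L by rewrite !divr_gt0.
have /nbhs_absCP [d d0 dP] := fD _ e1.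
near=> h.
have h1 : absC (g (z + h) - g z - dg * h) <= 1 * absC h.
  by near: h; apply: gD.
have h2 : absC (g (z + h) - g z - dg * h) <= e / 2 / L * absC h.
  by near: h; apply: gD.
have h3 : absC h < d / K.
  near: h; apply/nbhs_absCP; exists (d / K); first by rewrite divr_gt0.
  by move=> w; rewrite subr0.
set k := g (z + h) - g z in h1 h2.
have kh : absC k <= K * absC h.
  have := absCD (k - dg * h) (dg * h); rewrite subrK absCM /K; lra.
have /dP : absC (k - 0) < d.
  by rewrite subr0; apply: le_lt_trans kh _; rewrite mulrC -ltr_pdivlMr.
have -> : g z + k = g (z + h) by rewrite /k addrC subrK.
move=> h4.
have -> : f (g (z + h)) - f (g z) - df * dg * h
    = (f (g (z + h)) - f (g z) - df * k) + df * (k - dg * h) by ring.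
apply: le_trans (absCD _ _) _; rewrite absCM.
have i1 : e / 2 / K * absC k <= e / 2 * absC h.
  by rewrite mulrAC ler_pdivrMr // -[leRHS]mulrA [absC h * K]mulrC ler_wpM2l // divr_ge0 // ltW.
have i2 : absC df * absC (k - dg * h) <= e / 2 * absC h.
  apply: (@le_trans _ _ (L * (e / 2 / L * absC h))).
    by apply: ler_pM; rewrite ?absC_ge0 // /L lerDl.
  by rewrite mulrA [L * _]mulrC divfK // lt0r_neq0.
lra.
Unshelve. all: by end_near. Qed.

End ComplexDerivative.

(** * The complex exponential *)

Section ComplexExponential.
Variable R : realType.
Implicit Types (z w h s : Cx R) (e : R).

Lemma cexpD z w : cexp (z + w) = cexp z * cexp w.
Proof.
apply: Cx_eqP; rewrite ?reCM ?imCM /cexp !(reCD, imCD) /reC /imC /= expRD ?cosD ?sinD; ring.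
Qed.

Lemma absC_cexp z : absC (cexp z) = expR (reC z).
Proof.
by rewrite absCE /cexp /reC /imC /= !exprMn -mulrDr cos2Dsin2 mulr1 sqrtr_sqr ger0_norm ?expR_ge0.
Qed.

Lemma cexp_neq0 z : cexp z != 0.
Proof. by rewrite -absC_gt0 absC_cexp expR_gt0. Qed.

Lemma cexp0 : cexp 0 = 1 :> Cx R.
Proof. by apply: Cx_eqP; rewrite /cexp /reC /imC /= expR0 ?cos0 ?sin0 ?mulr1 ?mulr0. Qed.

Lemma near0_reC (P : set R) :
  (\forall t \near (0 : R), P t) -> \forall h \near (0 : Cx R), P (reC h).
Proof.
move=> /nbhs_ballP [d /= d0 dP]; apply/nbhs_absCP; exists d => // h.
rewrite subr0 => hd; apply: dP; rewrite -ball_normE /= sub0r normrN.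
exact: le_lt_trans (reC_le _) hd.
Qed.

Lemma near0_imC (P : set R) :
  (\forall t \near (0 : R), P t) -> \forall h \near (0 : Cx R), P (imC h).
Proof.
move=> /nbhs_ballP [d /= d0 dP]; apply/nbhs_absCP; exists d => // h.
rewrite subr0 => hd; apply: dP; rewrite -ball_normE /= sub0r normrN.
exact: le_lt_trans (imC_le _) hd.
Qed.

Lemma is_derive_cexp0 : is_derive (0 : Cx R) (1 : Cx R) (@cexp R) (1 : Cx R).
Proof.
apply/is_derive_absCP => e e0; rewrite cexp0.
(* Six units of [n * absC h] cover the error: the real part contributes 1 + 2 and the imaginary part
   2 + 1, the 2 being a bound for [expR a]. *)
pose n := e / 6; have n0 : 0 < n by rewrite divr_gt0.
have /is_deriveR_absP /(_ _ n0) /near0_reC He := @is_derive_expR R 0.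
have /is_deriveR_absP /(_ _ n0) /near0_imC Hc := @is_derive_cos R 0.
have /is_deriveR_absP /(_ _ n0) /near0_imC Hs := @is_derive_sin R 0.
have /cvgrPdist_lt cexpR : expR h @[h --> (0 : R)] --> expR (0 : R).
  exact: continuous_expR.
(* The bound 1 gives [expR a] at most 2; the bound n controls the cross term [(expR a - 1) * b]. *)
pose m := Num.min 1 n; have m0 : 0 < m by rewrite lt_min ltr01 n0.
have /near0_reC Hm := cexpR _ m0.
near=> h.
have : `|expR (0 + reC h) - expR 0 - expR 0 * reC h| <= n * `|reC h| by near: h.
have : `|cos (0 + imC h) - cos 0 - (- sin 0) * imC h| <= n * `|imC h| by near: h.
have : `|sin (0 + imC h) - sin 0 - cos 0 * imC h| <= n * `|imC h| by near: h.
have : `|expR 0 - expR (reC h)| < m by near: h.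
rewrite !add0r expR0 sin0 cos0 !mul1r oppr0 mul0r !subr0 !addr0 distrC lt_min.
move=> /andP[E1 En] S Cc E.
have ha := reC_le h; have hb := imC_le h.
apply: le_trans (absC_le _) _.
set a := reC h in E E1 En S Cc ha *; set b := imC h in S Cc hb *.
have -> : reC (cexp h - 1 - h) = (expR a - 1 - a) + expR a * (cos b - 1).
  by rewrite !reCB /cexp /reC /= -/(reC h) -/(imC h) -/a -/b; ring.
have -> : imC (cexp h - 1 - h) = expR a * (sin b - b) + (expR a - 1) * b.
  by rewrite !imCB /cexp /imC /= -/(reC h) -/(imC h) -/a -/b; ring.
have ea : `|expR a| <= 2.
  by have := ler_normD (expR a - 1) 1; rewrite subrK normr1; lra.
have i1 := ler_normD (expR a - 1 - a) (expR a * (cos b - 1)).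
have i2 := ler_normD (expR a * (sin b - b)) ((expR a - 1) * b).
rewrite !normrM in i1 i2.
have i3 : `|expR a| * `|cos b - 1| <= 2 * (n * `|b|) by apply: ler_pM.
have i4 : `|expR a| * `|sin b - b| <= 2 * (n * `|b|) by apply: ler_pM.
have i5 : `|expR a - 1| * `|b| <= n * `|b| by rewrite ler_wpM2r // ltW.
have i6 : n * `|a| <= n * absC h by rewrite ler_wpM2l // ltW.
have i7 : n * `|b| <= n * absC h by rewrite ler_wpM2l // ltW.
have -> : e * absC h = 6 * (n * absC h) by rewrite /n; field.
lra.
Unshelve. all: by end_near. Qed.

Lemma is_derive_cexp z : is_derive z 1 (@cexp R) (cexp z).
Proof.
apply/is_derive_absCP => e e0.
have ez : 0 < e / absC (cexp z) by rewrite divr_gt0 // absC_gt0 cexp_neq0.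
have /is_derive_absCP /(_ _ ez) := is_derive_cexp0; apply: filterS => h.
rewrite add0r cexp0 mul1r => hh.
rewrite cexpD (_ : _ - _ = cexp z * (cexp h - 1 - h)); last by ring.
rewrite absCM mulrC -ler_pdivlMr ?absC_gt0 ?cexp_neq0 //.
by rewrite mulrAC.
Qed.

Lemma continuous_cexp z : cexp w @[w --> z] --> cexp z.
Proof. by apply: derivable_cvg; case: (is_derive_cexp z). Qed.

Lemma continuous_eps_delta (f : R -> R) (x : R) : {for x, continuous f} ->
  forall e, 0 < e -> exists2 d, 0 < d & forall y, `|y - x| < d -> `|f y - f x| < e.
Proof.
move=> /cvgrPdist_lt fc e e0; have /nbhs_ballP [d /= d0 dP] := fc _ e0.
exists d => // y yd; rewrite distrC; apply: dP.
by rewrite -ball_normE /= distrC.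
Qed.

(** The witness is the principal logarithm [ln |w| + i atan (y / x)], valid for positive real part x
    and continuous at 1, where it vanishes. *)
Lemma cexp_surj_near1 (d : R) : 0 < d -> exists2 r, 0 < r &
  forall w, absC (w - 1) < r -> exists2 u, absC u < d & cexp u = w.
Proof.
move=> d0; have d2 : 0 < d / 2 by rewrite divr_gt0.
have [d1 d10 H1] := continuous_eps_delta (@continuous_ln R 1 ltr01) d2.
have [d3 d30 H3] := continuous_eps_delta (@continuous_atan R 0) d2.
(* 1/2 keeps x above 1/2; d1 makes the logarithm of the modulus small; d3 / 2 bounds y, and since x
   > 1/2 the quotient y / x stays below d3. *)
pose r := Num.min (1 / 2) (Num.min d1 (d3 / 2)).
have r0 : 0 < r by rewrite !lt_min d10 !divr_gt0.
exists r => // w; rewrite !lt_min => /and3P[w1 w2 w3].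
have x1 := reC_le (w - 1); have y1 := imC_le (w - 1).
move: x1 y1; rewrite reCB imCB /reC /imC /= -/(reC w) -/(imC w) subr0 => x1 y1.
set x := reC w in x1 *; set y := imC w in y1 *.
have x0 : 1 / 2 < x by move: x1; rewrite ler_norml => /andP[]; lra.
have xp : 0 < x by lra.
have wx : absC w = x * Num.sqrt (1 + (y / x) ^+ 2).
  rewrite absCE -/x -/y -{2}[x]ger0_norm ?ltW // -sqrtr_sqr -sqrtrM ?sqr_ge0 //.
  by congr Num.sqrt; field; rewrite lt0r_neq0.
have wp : 0 < absC w by rewrite wx mulr_gt0 // sqrtr_gt0 ltr_pwDl // sqr_ge0.
have sp : 0 < Num.sqrt (1 + (y / x) ^+ 2) by rewrite sqrtr_gt0 ltr_pwDl // sqr_ge0.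
exists (mkC (ln (absC w)) (atan (y / x))).
  apply: le_lt_trans (absC_le _) _; rewrite /reC /imC /= -/(absC w).
  have : `|ln (absC w)| < d / 2.
    have := H1 (absC w); rewrite ln1 subr0; apply.
    rewrite -[X in absC w - X](absC1 R).
    apply: le_lt_trans w2; rewrite ler_norml absCB_ge andbT lerNl opprB.
    by rewrite [leRHS]absCB absCB_ge.
  have : `|atan (y / x)| < d / 2.
    have := H3 (y / x); rewrite atan0 !subr0; apply.
    rewrite normrM normfV (gtr0_norm xp) ltr_pdivrMr //.
    have : d3 / 2 < d3 * x by rewrite ltr_pM2l //; lra.
    lra.
  lra.
have ct : cos (atan (y / x)) = x / absC w.
  by rewrite cos_atan wx; field; rewrite !lt0r_neq0.
apply: Cx_eqP; rewrite /cexp /reC /imC /= -/(absC w) lnK ?posrE // -/(reC w) -/(imC w) -/x -/y.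
  by rewrite ct mulrC divfK // lt0r_neq0.
have cn0 : cos (atan (y / x)) != 0 by rewrite ct mulf_neq0 ?invr_eq0 ?lt0r_neq0.
have st : sin (atan (y / x)) = y / x * cos (atan (y / x)).
  by rewrite -{2}[y / x]atanK /tan divfK.
by rewrite st ct; field; rewrite !lt0r_neq0.
Qed.

Lemma cexp_surj_near s0 (d : R) : 0 < d -> exists2 r, 0 < r &
  forall z, absC (z - cexp s0) < r -> exists2 s, absC (s - s0) < d & cexp s = z.
Proof.
move=> d0; have [r r0 H] := cexp_surj_near1 d0.
have z0 := cexp_neq0 s0; have az0 : 0 < absC (cexp s0) by rewrite absC_gt0.
exists (r * absC (cexp s0)); first by rewrite mulr_gt0.
move=> z zr.
have [u ud ue] : exists2 u, absC u < d & cexp u = z / cexp s0.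
  apply: H; rewrite (_ : z / _ - 1 = (z - cexp s0) / cexp s0); last by field.
  by rewrite absCM absCV ltr_pdivrMr.
exists (s0 + u); first by rewrite [s0 + u]addrC addrK.
by rewrite cexpD ue mulrC divfK.
Qed.

(** The local inverse of exp is Lipschitz. Subtracting the linear map with slope [cexp s0] from exp
    leaves a function with small derivative near s0, so exp separates points almost as much as that
    linear map does. *)
Lemma cexp_expanding s0 : exists K d : R, [/\ 0 < K, 0 < d &
  forall s s', absC (s - s0) < d -> absC (s' - s0) < d ->
    absC (s - s') <= K * absC (cexp s - cexp s')].
Proof.
set z0 := cexp s0; have az0 : 0 < absC z0 by rewrite absC_gt0 cexp_neq0.
(* The mean value inequality doubles the quarter to a half; absorbing it on the left leaves the
   constant [2 / absC z0]. *)
have q0 : 0 < absC z0 / 4 by rewrite divr_gt0.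
have /cvg_absCP /(_ _ q0) := @continuous_cexp s0; move=> /nbhs_absCP [d d0 dP].
exists (2 / absC z0), d; split => //; first by rewrite divr_gt0.
move=> s s' sd sd'.
pose f w : Cx R := cexp w - z0 * w.
have fD w : is_derive w 1 f (cexp w - z0).
  apply: is_deriveB; first exact: is_derive_cexp.
  have := is_deriveM (is_derive_cst z0 w (1 : Cx R)) (is_derive_id w (1 : Cx R)).
  by rewrite /= scaler0 addr0 [_ *: 1]mulr1.
have := @mean_value_absC R [set w | absC (w - s0) < d] f (fun w => cexp w - z0)
  (absC z0 / 4) s' s (@convexC_ball R s0 d) (fun w _ => fD w)
  (fun w wd => ltW (dP w wd)) sd' sd.
have := absCD (f s' - f s) (cexp s - cexp s').
have -> : f s' - f s + (cexp s - cexp s') = z0 * (s - s') by rewrite /f; ring.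
rewrite absCM [absC (f s' - f s)]absCB => h1 h2.
rewrite mulrAC ler_pdivlMr // mulrC; lra.
Qed.

End ComplexExponential.

(** * Matrix functions and linear equations *)

Section MatrixDerivative.
Variable R : realType.
Implicit Types (z w s : Cx R).

Definition mx_derivable m n (F : Cx R -> 'M[Cx R]_(m, n)) z :=
  forall i j, derivable (fun w => F w i j) z 1.

Lemma mx_derivable_const m n (A : 'M[Cx R]_(m, n)) z : mx_derivable (fun=> A) z.
Proof. by move=> i j; exact: derivable_const. Qed.

Lemma mx_derivable_mul m n p (F : Cx R -> 'M[Cx R]_(m, n))
    (G : Cx R -> 'M[Cx R]_(n, p)) z :
  mx_derivable F z -> mx_derivable G z -> mx_derivable (fun w => F w *m G w) z.
Proof.
move=> FD GD i j; under eq_fun do rewrite mxE.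
apply: derivable_bigsum => k; exact: derivable_mul (FD i k) (GD k j).
Qed.

Lemma mx_derivable_opp m n (F : Cx R -> 'M[Cx R]_(m, n)) z :
  mx_derivable F z -> mx_derivable (fun w => - F w) z.
Proof.
move=> FD i j; under eq_fun do rewrite mxE; exact: derivable_neg (FD i j).
Qed.

Lemma mx_derivable_block m1 m2 n1 n2 (A : Cx R -> 'M[Cx R]_(m1, n1))
    (B : Cx R -> 'M[Cx R]_(m1, n2)) (C : Cx R -> 'M[Cx R]_(m2, n1))
    (D : Cx R -> 'M[Cx R]_(m2, n2)) z :
  mx_derivable A z -> mx_derivable B z -> mx_derivable C z -> mx_derivable D z ->
  mx_derivable (fun w => block_mx (A w) (B w) (C w) (D w)) z.
Proof.
move=> AD BD CD DD i j; case: (split_ordP i) => i' ->; case: (split_ordP j) => j' ->.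
- under eq_fun do rewrite block_mxEul; exact: AD.
- under eq_fun do rewrite block_mxEur; exact: BD.
- under eq_fun do rewrite block_mxEdl; exact: CD.
- under eq_fun do rewrite block_mxEdr; exact: DD.
Qed.

Lemma derivable_det n (F : Cx R -> 'M[Cx R]_n) z :
  mx_derivable F z -> derivable (fun w => \det (F w)) z 1.
Proof.
move=> FD; apply: derivable_bigsum => s.
apply: derivable_mul; first exact: derivable_const.
by apply: derivable_bigprod => i; exact: FD.
Qed.

(** Cramer's formula makes the inverse rational in the entries. [invmx] returns its argument on
    singular matrices, so the formula requires invertibility on a whole neighbourhood. *)
Lemma mx_derivable_inv n (F : Cx R -> 'M[Cx R]_n) z :
  (\forall w \near z, F w \in unitmx) ->
  mx_derivable F z -> mx_derivable (fun w => invmx (F w)) z.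
Proof.
move=> Fu FD i j.
have z0 : \det (F z) != 0 by have := nbhs_singleton Fu; rewrite unitmxE unitfE.
pose f w := (\det (F w))^-1 * cofactor (F w) j i.
have fF : {near z, f =1 (fun w => invmx (F w) i j)}.
  by apply: filterS Fu => w wu; rewrite /f /invmx wu !mxE.
apply: (near_eq_derivable fF).
apply: derivable_mul; first exact: derivable_inv z0 (derivable_det FD).
apply: derivable_mul; first exact: derivable_const.
apply: derivable_det => a b; under eq_fun do rewrite !mxE.
exact: FD.
Qed.

Definition mx_is_derive m n (F : Cx R -> 'M[Cx R]_(m, n)) z (dF : 'M[Cx R]_(m, n)) :=
  forall i j, is_derive z 1 (fun w => F w i j) (dF i j).

Lemma mx_derivableP m n (F : Cx R -> 'M[Cx R]_(m, n)) z :
  mx_derivable F z -> mx_is_derive F z (mx_deriv F z).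
Proof. by move=> FD i j; rewrite mxE; exact: derivable_is_derive. Qed.

Lemma mx_is_derive_unique m n (F : Cx R -> 'M[Cx R]_(m, n)) z dF dF' :
  mx_is_derive F z dF -> mx_is_derive F z dF' -> dF = dF'.
Proof. by move=> D D'; apply/matrixP => i j; case: (D i j) => _ <-; case: (D' i j). Qed.

Lemma mx_is_derive_mul m n p (F : Cx R -> 'M[Cx R]_(m, n))
    (G : Cx R -> 'M[Cx R]_(n, p)) z dF dG :
  mx_is_derive F z dF -> mx_is_derive G z dG ->
  mx_is_derive (fun w => F w *m G w) z (dF *m G z + F z *m dG).
Proof.
move=> FD GD i j; under eq_fun do rewrite mxE.
rewrite !mxE -big_split /=.
exact: is_derive_bigsum (fun k => is_derive_mul (FD i k) (GD k j)).
Qed.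

Lemma mx_is_derive_comp m n (F : Cx R -> 'M[Cx R]_(m, n)) (f : Cx R -> Cx R) z dF df :
  is_derive z 1 f df -> mx_is_derive F (f z) dF ->
  mx_is_derive (fun w => F (f w)) z (df *: dF).
Proof.
by move=> fD FD i j; rewrite mxE mulrC; exact: is_derive_comp fD (FD i j).
Qed.

(* If F' = a F and G' = a G then, writing G = F K, F K' = 0. *)
Lemma linear_ode_ratio n (D : set (Cx R)) (c : Cx R -> Cx R)
    (A F G dF dG : Cx R -> 'M[Cx R]_n) s t :
  convexC D -> open D ->
  (forall z, D z -> c z != 0) -> (forall z, D z -> F z \in unitmx) ->
  (forall z, D z -> mx_is_derive F z (dF z) /\ c z *: dF z = A z *m F z) ->
  (forall z, D z -> mx_is_derive G z (dG z) /\ c z *: dG z = A z *m G z) ->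
  D s -> D t -> invmx (F s) *m G s = invmx (F t) *m G t.
Proof.
move=> cD oD c0 Fu FD GD Ds Dt.
pose K z := invmx (F z) *m G z.
have KD z : D z -> mx_is_derive K z 0.
  move=> Dz; have [FDz FE] := FD z Dz; have [GDz GE] := GD z Dz.
  have nD : \forall w \near z, D w by exact: open_nbhs_nbhs.
  have KDz : mx_derivable K z.
    apply: mx_derivable_mul; last by move=> i j; case: (GDz i j).
    apply: mx_derivable_inv; first by apply: filterS nD => w; exact: Fu.
    by move=> i j; case: (FDz i j).
  have KDz' := mx_derivableP KDz.
  suff K0 : mx_deriv K z = 0 by move: KDz'; rewrite K0.
  (* Differentiating the identity G = F K, valid near z, avoids computing the derivative of an
     inverse; comparison with the equation for G leaves only the term F K'. *)
  have FK : mx_is_derive G z (dF z *m K z + F z *m mx_deriv K z).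
    have := mx_is_derive_mul FDz KDz' => H i j.
    apply: (near_eq_is_derive _ (H i j)).
    by apply: filterS nD => w Dw; rewrite /K mulmxA mulmxV ?mul1mx ?Fu.
  have dGE := mx_is_derive_unique GDz FK.
  have FKz : F z *m K z = G z by rewrite mulmxA mulmxV ?mul1mx ?Fu.
  have : c z *: (F z *m mx_deriv K z) = 0.
    apply: (addrI (c z *: (dF z *m K z))).
    by rewrite -scalerDr -dGE GE addr0 -FKz mulmxA -FE scalemxAl.
  move/eqP; rewrite scaler_eq0 (negPf (c0 z Dz)) /= => /eqP FK0.
  by rewrite -[LHS]mul1mx -(mulVmx (Fu z Dz)) -mulmxA FK0 mulmx0.
apply/matrixP => i j; apply: (@derive0_convex_const R D (fun z => K z i j) s t cD _ Ds Dt) => z Dz.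
by have := KD z Dz i j; rewrite mxE.
Qed.

End MatrixDerivative.

(** * Locally Lipschitz functions *)

Section LocalLipschitz.
Variable R : realType.
Implicit Types (z w s : Cx R) (f : Cx R -> Cx R).

(** Both points vary near the centre: the Cauchy integral compares a value at a loop point w with
    one at a point z off the loop, while both approach a third point. *)
Definition locally_lipschitz f z := exists L r : R, [/\ 0 <= L, 0 < r &
  forall a b, absC (a - z) < r -> absC (b - z) < r ->
    absC (f a - f b) <= L * absC (a - b)].

Lemma locally_lipschitz_const (c : Cx R) z : locally_lipschitz (fun=> c) z.
Proof. by exists 0, 1; split => // a b _ _; rewrite subrr absC0 mul0r. Qed.

Lemma locally_lipschitz_id z : locally_lipschitz (fun w => w) z.
Proof. by exists 1, 1; split => // a b _ _; rewrite mul1r. Qed.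

Lemma locally_lipschitz_add f g z : locally_lipschitz f z -> locally_lipschitz g z ->
  locally_lipschitz (fun w => f w + g w) z.
Proof.
move=> [L [r [L0 r0 H]]] [L' [r' [L0' r0' H']]].
exists (L + L'), (Num.min r r'); split; rewrite ?addr_ge0 // ?lt_min ?r0 //.
move=> a b; rewrite !lt_min => /andP[a1 a2] /andP[b1 b2].
rewrite mulrDl.
have -> : f a + g a - (f b + g b) = (f a - f b) + (g a - g b) by ring.
by apply: le_trans (absCD _ _) _; rewrite lerD ?H ?H'.
Qed.

Lemma locally_lipschitz_mul f g z : locally_lipschitz f z -> locally_lipschitz g z ->
  locally_lipschitz (fun w => f w * g w) z.
Proof.
move=> [L [r [L0 r0 H]]] [L' [r' [L0' r0' H']]].
(* From [f a g a - f b g b = f a (g a - g b) + g b (f a - f b)], the parenthesised sums being bounds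
   for [f a] and [g b] on the two balls. *)
exists ((absC (f z) + L * r) * L' + (absC (g z) + L' * r') * L), (Num.min r r').
split.
- by rewrite addr_ge0 // mulr_ge0 // addr_ge0 ?absC_ge0 // mulr_ge0 // ltW.
- by rewrite lt_min r0.
move=> a b; rewrite !lt_min => /andP[a1 a2] /andP[b1 b2].
have fa : absC (f a) <= absC (f z) + L * r.
  have h : absC (z - z) < r by rewrite subrr absC0.
  have := absCD (f a - f z) (f z); rewrite subrK; have := H a z a1 h.
  have : L * absC (a - z) <= L * r by rewrite ler_wpM2l // ltW.
  lra.
have gb : absC (g b) <= absC (g z) + L' * r'.
  have h : absC (z - z) < r' by rewrite subrr absC0.
  have := absCD (g b - g z) (g z); rewrite subrK; have := H' b z b2 h.
  have : L' * absC (b - z) <= L' * r' by rewrite ler_wpM2l // ltW.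
  lra.
have -> : f a * g a - f b * g b = f a * (g a - g b) + g b * (f a - f b) by ring.
apply: le_trans (absCD _ _) _; rewrite !absCM mulrDl -!mulrA.
by rewrite lerD // ler_pM ?absC_ge0 // ?H ?H'.
Qed.

Lemma locally_lipschitz_sum (I : Type) (r : seq I) (P : pred I)
    (f : I -> Cx R -> Cx R) z :
  (forall i, locally_lipschitz (f i) z) ->
  locally_lipschitz (fun w => \sum_(i <- r | P i) f i w) z.
Proof.
move=> fD; elim: r => [|i r IH].
  under eq_fun do rewrite big_nil; exact: locally_lipschitz_const.
under eq_fun do rewrite big_cons.
by case: (P i); [exact: locally_lipschitz_add | exact: IH].
Qed.

Lemma locally_lipschitz_horner (p : {poly Cx R}) z :
  locally_lipschitz (fun w => p.[w]) z.
Proof.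
elim/poly_ind: p => [|p c IH].
  under eq_fun do rewrite horner0; exact: locally_lipschitz_const.
under eq_fun do rewrite hornerMXaddC.
apply: locally_lipschitz_add; last exact: locally_lipschitz_const.
exact: locally_lipschitz_mul IH (locally_lipschitz_id z).
Qed.

Lemma derivable_poly (p : {poly Cx R}) z : derivable (fun w => p.[w]) z 1.
Proof.
elim/poly_ind: p => [|p c IH].
  under eq_fun do rewrite horner0; exact: derivable_const.
under eq_fun do rewrite hornerMXaddC.
apply: derivable_add; last exact: derivable_const.
apply: derivable_mul; first exact: IH.
exact: is_derive_derivable (is_derive_ident z).
Qed.

Lemma locally_lipschitz_cvg f z : locally_lipschitz f z -> f w @[w --> z] --> f z.
Proof.
move=> [L [r [L0 r0 H]]]; apply/(cvg_absCP (nbhs_filter z) f (f z)) => e e0.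
have L1 : 0 < L + 1 by rewrite ltr_wpDl.
apply/nbhs_absCP; exists (Num.min r (e / (L + 1))).
  by rewrite lt_min r0 divr_gt0.
move=> w; rewrite lt_min => /andP[wr]; rewrite ltr_pdivlMr // => we.
have h : absC (z - z) < r by rewrite subrr absC0.
apply: le_lt_trans (H w z wr h) (le_lt_trans _ we).
by rewrite mulrC ler_wpM2l ?absC_ge0 // lerDl.
Qed.

Lemma nonexpansive_continuous (h : Cx R -> R) :
  (forall a b, `|h a - h b| <= absC (a - b)) -> continuous h.
Proof.
move=> H z; have FF : Filter (nbhs z) by exact: nbhs_filter.
apply/(@cvgrPdist_lt _ _ _ _ FF) => e e0; apply/nbhs_absCP; exists e => // w wz.
by apply: le_lt_trans (H _ _) _; rewrite absCB.
Qed.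

Lemma continuous_absC : continuous (@absC R).
Proof.
apply: nonexpansive_continuous => a b.
by rewrite ler_norml absCB_ge andbT lerNl opprB [leRHS]absCB absCB_ge.
Qed.

Lemma continuous_reC : continuous (@reC R).
Proof. by apply: nonexpansive_continuous => a b; rewrite -reCB reC_le. Qed.

Lemma continuous_imC : continuous (@imC R).
Proof. by apply: nonexpansive_continuous => a b; rewrite -imCB imC_le. Qed.

End LocalLipschitz.

(** * Compactness of the loop *)

Section LoopGeometry.
Variables (R : realType) (g : R -> Cx R).
Hypothesis g_cont : {within `[0, 1], continuous g}.
Implicit Types z : Cx R.

Lemma within_loop_comp (T : topologicalType) (h : Cx R -> T) :
  (forall t, 0 <= t <= 1 -> {for g t, continuous h}) ->
  {within `[0, 1], continuous (fun t => h (g t))}.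
Proof.
move=> hc; apply/subspace_continuousP => t t01.
have /subspace_continuousP /(_ t t01) gt := g_cont.
by apply: (cvg_comp _ _ gt); apply: hc; move: t01; rewrite /= in_itv.
Qed.

Lemma loop_bounded : exists2 M : R, 0 <= M & forall t, 0 <= t <= 1 -> absC (g t) <= M.
Proof.
have c : {within `[(0:R), 1], continuous (fun t => absC (g t))}.
  by apply: within_loop_comp => t _; exact: continuous_absC.
have [u _ uM] := EVT_max ler01 c.
exists (absC (g u)); first exact: absC_ge0.
by move=> t t01; apply: uM; rewrite in_itv.
Qed.

(** The continuous distance to z attains its minimum on the compact parameter interval, and this
    minimum is not 0. *)
Lemma loop_dist z : ~ loop_set g z ->
  exists2 d : R, 0 < d & forall t, 0 <= t <= 1 -> d <= absC (g t - z).
Proof.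
move=> zg.
have hc : continuous (fun w => absC (w - z)).
  apply: nonexpansive_continuous => a b.
  have -> : a - b = (a - z) - (b - z) by ring.
  by rewrite ler_norml absCB_ge andbT lerNl opprB [leRHS]absCB absCB_ge.
have c : {within `[(0:R), 1], continuous (fun t => absC (g t - z))}.
  by apply: (@within_loop_comp _ (fun w => absC (w - z))) => t _; exact: hc.
have [u u01 um] := EVT_min ler01 c.
exists (absC (g u - z)).
  rewrite absC_gt0 subr_eq0; apply/eqP => gu; apply: zg; exists u => //.
by move=> t t01; apply: um; rewrite in_itv.
Qed.

Lemma loop_compl_near z : ~ loop_set g z -> \forall w \near z, ~ loop_set g w.
Proof.
move=> /loop_dist [d d0 H]; apply/nbhs_absCP; exists d => // w wd [t].
rewrite /= in_itv /= => /H + wE; rewrite wE leNgt; by rewrite wd.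
Qed.

End LoopGeometry.

(** * Solutions across the loop *)

Section SolutionsAcrossLoop.
Variables (R : realType) (N : nat) (g : R -> Cx R).
Hypothesis g_cont : {within `[0, 1], continuous g}.
Implicit Types (h F W : Cx R -> 'M[Cx R]_N) (s T : Cx R).

Lemma multivalued_solution_ode h F s : multivalued_left_solution h F ->
  mx_is_derive F s (mx_deriv F s) /\ cexp s *: mx_deriv F s = h (cexp s) *m F s.
Proof.
move=> [FD Fe]; split; last by case: (Fe s).
by apply: mx_derivableP => i j; apply: FD.
Qed.

(* The half-plane [x0 < reC s] is mapped by [cexp] into the unbounded side of
   the loop. *)
Lemma solution_on_half_plane h F W : left_solution g h W ->
  multivalued_left_solution h F -> branch_on (~` loop_set g) F W ->
  exists x0 : R, forall s, x0 < reC s -> W (cexp s) = F s.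
Proof.
move=> [WD _ We _] Fs FW; have [M M0 gM] := loop_bounded g_cont.
have M1 : 0 < M + 1 by rewrite ltr_wpDl.
(* Beyond this abscissa the modulus [expR (reC s)] of [cexp s] exceeds M + 1, whereas the loop has
   modulus at most M. *)
exists (ln (M + 1)).
set D := [set s : Cx R | ln (M + 1) < reC s].
have Dout s : D s -> ~ loop_set g (cexp s).
  move=> Ds [t]; rewrite /= in_itv /= => /gM + gt.
  rewrite gt absC_cexp leNgt => /negP; apply.
  have : M + 1 < expR (reC s) by rewrite -[M + 1]lnK ?posrE // ltr_expR.
  lra.
have cD : convexC D by exact: convexC_half.
have oD : open D.
  rewrite openE => s Ds; apply/nbhs_absCP; exists (reC s - ln (M + 1)).
    by rewrite subr_gt0.
  move=> w ws; have := le_lt_trans (reC_le _) ws; rewrite reCB ltr_norml.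
  by rewrite /D /= => /andP[]; lra.
(* By the chain rule one factor [cexp s] of z^2 goes into the derivative of W(exp s); the other
   remains as the coefficient in the equation of F. *)
have WfD s : D s -> mx_is_derive (fun u => W (cexp u)) s (cexp s *: mx_deriv W (cexp s))
    /\ cexp s *: (cexp s *: mx_deriv W (cexp s)) = h (cexp s) *m W (cexp s).
  move=> /Dout Ds; split; last by rewrite scalerA -expr2 We.
  apply: mx_is_derive_comp; first exact: is_derive_cexp.
  by apply: mx_derivableP => i j; apply: WD.
pose s0 : Cx R := mkC (ln (M + 1) + 1) 0.
have Ds0 : D s0 by rewrite /D /s0 /reC /=; lra.
have [s1 [s1e FWs1]] := FW _ (Dout _ Ds0).
(* The branch may choose another logarithm s1 of [cexp s0], but equal moduli give equal real parts,
   so s1 stays in the half-plane. *)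
have Ds1 : D s1.
  have : absC (cexp s1) = absC (cexp s0) by rewrite s1e.
  by rewrite !absC_cexp => /expR_inj e; rewrite /D /= e.
move=> s Ds.
have Fu u : F u \in unitmx by case: Fs => _ /(_ u) [].
have := @linear_ode_ratio R N D (@cexp R) (fun u => h (cexp u)) F
  (fun u => W (cexp u)) (mx_deriv F) (fun u => cexp u *: mx_deriv W (cexp u)) s s1
  cD oD (fun u _ => cexp_neq0 u) (fun u _ => Fu u)
  (fun u _ => multivalued_solution_ode u Fs) WfD Ds Ds1.
rewrite (nbhs_singleton FWs1) mulVmx // => e.
by rewrite -[LHS]mul1mx -(mulmxV (Fu s)) -mulmxA e mulmx1.
Qed.

(* [F s] only depends on [cexp s]: the translate of F by a period T of cexp
   solves the same equation and agrees with F on the half-plane. *)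
Lemma solution_factors h F W : left_solution g h W ->
  multivalued_left_solution h F -> branch_on (~` loop_set g) F W ->
  forall s s', cexp s = cexp s' -> F s = F s'.
Proof.
move=> Ws Fs FW; have [x0 H] := solution_on_half_plane Ws Fs FW.
move=> s s' ss'; pose T := s - s'.
have cT u : cexp (u + T) = cexp u.
  rewrite cexpD (_ : cexp T = 1) ?mulr1 //.
  by apply: (mulfI (cexp_neq0 s')); rewrite -cexpD mulr1 -ss' addrC subrK.
(* Periods of exp are purely imaginary, so translation by T preserves the half-plane. *)
have rT : reC T = 0.
  have : absC (cexp (0 + T)) = absC (cexp 0) by rewrite cT.
  by rewrite !absC_cexp add0r => /expR_inj.
pose u0 : Cx R := mkC (x0 + 1) 0.
have u0D : x0 < reC u0 by rewrite /u0 /reC /=; lra.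
have u0T : x0 < reC (u0 + T) by rewrite reCD rT addr0.
have Fu0 : F (u0 + T) = F u0 by rewrite -(H _ u0T) cT H.
have Fu u : F u \in unitmx by case: Fs => _ /(_ u) [].
have FTD u : setT u -> mx_is_derive (fun v => F (v + T)) u (mx_deriv F (u + T)) /\
    cexp u *: mx_deriv F (u + T) = h (cexp u) *m F (u + T).
  move=> _; have [FD Fe] := multivalued_solution_ode (u + T) Fs.
  split; last by rewrite cT in Fe.
  have := is_derive_add (is_derive_ident u) (is_derive_const T u).
  by rewrite addr0 => /mx_is_derive_comp /(_ FD); rewrite scale1r.
(* On the whole plane the ratio of F and its translate is constant; at u0 in the half-plane it is
   the identity. *)
have := @linear_ode_ratio R N setT (@cexp R) (fun u => h (cexp u)) F
  (fun u => F (u + T)) (mx_deriv F) (fun u => mx_deriv F (u + T)) s' u0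
  (@convexC_setT R) openT (fun u _ => cexp_neq0 u) (fun u _ => Fu u)
  (fun u _ => multivalued_solution_ode u Fs) FTD Logic.I Logic.I.
rewrite Fu0 mulVmx // => e.
have -> : F s = F (s' + T) by congr F; rewrite /T addrC subrK.
by rewrite -[LHS]mul1mx -(mulmxV (Fu s')) -mulmxA e mulmx1.
Qed.

(** Solved for F', the equation displays the derivative as a product of differentiable functions. It
    is therefore continuous, hence bounded near s, and the mean value inequality applies. *)
Lemma multivalued_solution_lipschitz h F s i j : mx_holomorphic_on setT h ->
  multivalued_left_solution h F -> locally_lipschitz (fun u => F u i j) s.
Proof.
move=> hD Fs.
have FD u : mx_is_derive F u (mx_deriv F u) by case: (multivalued_solution_ode u Fs).
pose D u := (cexp u)^-1 * \sum_k h (cexp u) i k * F u k j.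
have dFE u : mx_deriv F u i j = D u.
  have [_ /matrixP /(_ i j)] := multivalued_solution_ode u Fs.
  rewrite [LHS]mxE [RHS]mxE => e; apply: (mulfI (cexp_neq0 u)).
  by rewrite e /D mulrA mulfV ?mul1r // cexp_neq0.
have DD : derivable D s 1.
  have cD : derivable (@cexp R) s 1 := is_derive_derivable (is_derive_cexp s).
  apply: derivable_mul.
    exact: derivable_inv (cexp_neq0 s) cD.
  apply: derivable_bigsum => k; apply: derivable_mul.
    have hk := derivable_is_derive (hD i k (cexp s) Logic.I).
    exact: is_derive_derivable (is_derive_comp (is_derive_cexp s) hk).
  exact: is_derive_derivable (FD s k j).
have Dc := derivable_cvg DD.
have /nbhs_absCP [r r0 rP] : \forall w \near s, absC (D w - D s) < 1.
  by move/(cvg_absCP (nbhs_filter s) D (D s)): Dc; apply.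
exists (2 * (absC (D s) + 1)), r; split => //.
  by rewrite mulr_ge0 // addr_ge0 ?absC_ge0.
move=> a b ar br.
have bound z : [set w | absC (w - s) < r] z -> absC (mx_deriv F z i j) <= absC (D s) + 1.
  move=> /rP zD; rewrite dFE.
  by have := absCD (D z - D s) (D s); rewrite subrK; lra.
exact: (@mean_value_absC R _ _ _ _ b a (@convexC_ball R s r)
  (fun z _ => FD z i j) bound br ar).
Qed.

(** E is F at any logarithm of z, which is unambiguous because F has the periods of exp. Near
    [cexp s] the logarithms can be taken near s, where F is Lipschitz and exp has a Lipschitz
    inverse. *)
Lemma left_solution_extension h W : mx_holomorphic_on setT h -> left_solution g h W ->
  exists E : Cx R -> 'M[Cx R]_N,
    [/\ forall s, E (cexp s) \in unitmx,
        forall s i j, locally_lipschitz (fun z => E z i j) (cexp s) &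
        forall z, ~ loop_set g z -> W z = E z].
Proof.
move=> hD Ws; have [_ _ _ [F Fs FW]] := Ws.
have Ff := solution_factors Ws Fs FW.
(* An arbitrary, possibly discontinuous choice of logarithm: only F of it matters. At z = 0 it takes
   the default 0, and regularity is claimed only at points [cexp s]. *)
pose lg (z : Cx R) : Cx R := xget (0 : Cx R) [set s : Cx R | cexp s = z].
have lgE s : F (lg (cexp s)) = F s.
  apply: Ff; have := @xgetPex _ (0 : Cx R) [set u : Cx R | cexp u = cexp s].
  by apply; exists s.
exists (fun z => F (lg z)); split.
- by move=> s; rewrite lgE; case: Fs => _ /(_ s) [].
- move=> s i j; have [L [r [L0 r0 H]]] := multivalued_solution_lipschitz s i j hD Fs.
  have [K [d [K0 d0 HK]]] := cexp_expanding s.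
  have m0 : 0 < Num.min r d by rewrite lt_min r0.
  have [e e0 He] := cexp_surj_near s m0.
  exists (L * K), e; split => //; first by rewrite mulr_ge0 // ltW.
  move=> a b /He [u + <-] /He [v + <-].
  rewrite !lt_min => /andP[ur ud] /andP[vr vd].
  rewrite !lgE; apply: le_trans (H u v ur vr) _.
  by rewrite -mulrA ler_wpM2l // HK.
- move=> z zl; have [s [<- /nbhs_singleton ->]] := FW z zl.
  by rewrite lgE.
Qed.

End SolutionsAcrossLoop.

(** Transposition reverses products and so turns the right equation into a left one, for the
    transposed coefficient. *)
Lemma right_solution_trmx (R : realType) N (g : R -> Cx R) (h W : Cx R -> 'M[Cx R]_N) :
  right_solution g h W -> left_solution g (fun z => (h z)^T) (fun z => (W z)^T).
Proof.
have trD (F : Cx R -> 'M[Cx R]_N) z : mx_deriv (fun w => (F w)^T) z = (mx_deriv F z)^T.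
  by apply/matrixP => i j; rewrite !mxE; congr ('D_1 _ z); apply/funext => w; rewrite mxE.
have trH D (F : Cx R -> 'M[Cx R]_N) : mx_holomorphic_on D F ->
    mx_holomorphic_on D (fun w => (F w)^T).
  by move=> FD i j z Dz; under eq_fun do rewrite mxE; exact: FD.
move=> [WD Wu We [F [FD Fe] FW]]; split.
- exact: trH.
- by move=> z zl; rewrite unitmx_tr Wu.
- by move=> z zl; rewrite trD -linearZ /= We // trmx_mul.
exists (fun s => (F s)^T).
  split; first exact: trH.
  move=> s; have [Fu Fs] := Fe s; split; first by rewrite unitmx_tr.
  by rewrite trD -linearZ /= Fs trmx_mul.
move=> z zl; have [s [sz sF]] := FW z zl; exists s; split => //.
by apply: filterS sF => u ->.
Qed.

Lemma right_solution_extension (R : realType) N (g : R -> Cx R)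
    (h W : Cx R -> 'M[Cx R]_N) : {within `[0, 1], continuous g} ->
  mx_holomorphic_on setT h -> right_solution g h W ->
  exists E : Cx R -> 'M[Cx R]_N,
    [/\ forall s, E (cexp s) \in unitmx,
        forall s i j, locally_lipschitz (fun z => E z i j) (cexp s) &
        forall z, ~ loop_set g z -> W z = E z].
Proof.
move=> gc hD /right_solution_trmx Ws.
have hD' : mx_holomorphic_on setT (fun z => (h z)^T).
  by move=> i j z _; under eq_fun do rewrite mxE; exact: hD.
have [E [Eu El EW]] := left_solution_extension gc hD' Ws.
exists (fun z => (E z)^T); split.
- by move=> s; rewrite unitmx_tr.
- by move=> s i j; under eq_fun do rewrite mxE; exact: El.
- by move=> z zl; rewrite -EW // trmxK.
Qed.

(** * Integrals along the loop *)

Section RealIntegral.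
Variable R : realType.
Local Notation mu := (@lebesgue_measure R).
Local Notation I := `[(0:R), 1]%classic.
Implicit Types (u v k : R -> R).

(** Meant for d the derivative of one smooth piece, which is not controlled at the ends. Two points
    do not spoil measurability, and their values are simply added to the bound. *)
Lemma measurable_itv_split (a b : R) (d d' : R -> R) : a < b ->
  {within `[a, b], continuous d'} -> (forall t, a < t < b -> d t = d' t) ->
  measurable_fun `[a, b]%classic d /\
  exists M, forall t, a <= t <= b -> `|d t| <= M.
Proof.
move=> ab d'c dd'; split.
  have -> : `[a, b]%classic = ([set a] `|` `]a, b[%classic) `|` [set b].
    by rewrite setU1itv ?bnd_simp // setUitv1 ?bnd_simp // ltW.
  apply/measurable_funU => //; first exact: measurableU.
  split; last exact: measurable_fun_set1.
  apply/measurable_funU => //; split; first exact: measurable_fun_set1.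
  apply: (@eq_measurable_fun _ _ _ _ _ d').
    by move=> t; rewrite inE /= in_itv /= => tab; rewrite dd'.
  apply: (@measurable_funS _ _ _ _ `[a, b]%classic) => //.
    by apply: subset_itvW.
  exact: subspace_continuous_measurable_fun.
have [c cab cM] : exists2 c, c \in `[a, b]%R & forall t, t \in `[a, b]%R -> `|d' t| <= `|d' c|.
  apply: (@EVT_max R (fun t => `|d' t|) a b (ltW ab)) => t.
  by apply: (continuous_comp (d'c t)); exact: norm_continuous.
exists (`|d' c| + `|d a| + `|d b|) => t /andP[ta tb].
have [->|na] := eqVneq t a; first by rewrite -addrA addrCA lerDl addr_ge0.
have [->|nb] := eqVneq t b; first by rewrite lerDr addr_ge0.
have t1 : a < t by rewrite lt_def na.
have t2 : t < b by rewrite lt_def eq_sym nb.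
rewrite dd' ?t1 // -addrA; apply: le_trans (cM t _) _; first by rewrite in_itv /= ta.
by rewrite lerDl addr_ge0.
Qed.

Lemma piecewise_C1_derive (n : nat) (a : nat -> R) (f : R -> R) :
  (forall k : nat, (k < n)%N -> a k < a k.+1 /\ C1_between (a k) (a k.+1) f) ->
  forall k : nat, (k <= n)%N -> a 0%N <= a k /\ measurable_fun `[a 0%N, a k]%classic (derive1 f) /\
  exists M, forall t, a 0%N <= t <= a k -> `|derive1 f t| <= M.
Proof.
move=> H; elim=> [_|k IH kn].
  split => //; split.
    by rewrite set_itv1; exact: measurable_fun_set1.
  exists `|derive1 f (a 0%N)| => t t0; have -> // : t = a 0%N.
  by apply/eqP; rewrite eq_le andbC.
have [a0k [mk [M HM]]] := IH (ltnW kn).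
have [akk [f' f'c f'D]] := H k kn.
have f'E t : a k < t < a k.+1 -> derive1 f t = f' t.
  by move=> /f'D tD; rewrite derive1E; case: tD.
have [mk' [M' HM']] := measurable_itv_split akk f'c f'E.
split; first exact: le_trans a0k (ltW akk).
split.
  apply: (@measurable_funS _ _ _ _ (`[a 0%N, a k]%classic `|` `[a k, a k.+1]%classic)).
  - exact: measurableU.
  - move=> t; rewrite /= !in_itv /= => /andP[t1 t2].
    by have [h|h] := leP t (a k); [left; rewrite t1|right; rewrite t2 (ltW h)].
  - exact/measurable_funU.
exists (Num.max M M') => t /andP[t1 t2]; rewrite le_max.
have [h|h] := leP t (a k); first by rewrite HM // t1.
by rewrite (HM' t) ?orbT // t2 ltW.
Qed.

Lemma path_deriv_measurable_bounded (g : R -> Cx R) : piecewise_C1 g ->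
  [/\ measurable_fun I (fun t => reC (path_deriv g t)),
      measurable_fun I (fun t => imC (path_deriv g t)) &
      exists2 M, 0 <= M & forall t, 0 <= t <= 1 -> absC (path_deriv g t) <= M].
Proof.
move=> [n [a [a0 an H]]].
have H1 (k : nat) : (k < n)%N -> a k < a k.+1 /\ C1_between (a k) (a k.+1) (fun t => reC (g t)).
  by case/H.
have H2 (k : nat) : (k < n)%N -> a k < a k.+1 /\ C1_between (a k) (a k.+1) (fun t => imC (g t)).
  by case/H.
have [_ [m1 [M1 B1]]] := piecewise_C1_derive H1 (leqnn n).
have [_ [m2 [M2 B2]]] := piecewise_C1_derive H2 (leqnn n).
rewrite a0 an in m1 B1 m2 B2; split => //.
exists (M1 + M2).
  have h : 0 <= (0 : R) <= 1 by rewrite lexx ler01.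
  have p1 := le_trans (normr_ge0 _) (B1 _ h).
  exact: addr_ge0 p1 (le_trans (normr_ge0 _) (B2 _ h)).
by move=> t t01; apply: le_trans (absC_le _) _; rewrite lerD // ?B1 ?B2.
Qed.

(** Dominated convergence is a statement on sequences; neighbourhoods of z0 have a countable base,
    so a failure of the limit is witnessed by a sequence. The parameter t0 is the one where the
    limiting integrand has its pole. *)
Lemma dominated_cvg_within (A : set (Cx R)) (z0 : Cx R) (t0 : R)
    (k : Cx R -> R -> R) (k0 dom : R -> R) :
  (\forall z \near z0, A z -> measurable_fun I (k z)) ->
  mu.-integrable I (EFin \o dom) ->
  (\forall z \near z0, A z -> forall t, 0 <= t <= 1 -> `|k z t| <= dom t) ->
  (forall t, 0 <= t <= 1 -> t != t0 -> k z t @[z --> within A (nbhs z0)] --> k0 t) ->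
  \int[mu]_(t in I) k z t @[z --> within A (nbhs z0)] --> \int[mu]_(t in I) k0 t.
Proof.
move=> mk idom kdom kk0.
have FF : Filter (within A (nbhs z0)) by apply: within_filter; exact: nbhs_filter.
apply/(@cvgrPdist_lt _ _ _ _ FF) => e e0.
apply: contrapT => /=; rewrite /within /= => nH.
(* If the limit fails, each ball of radius 1 / (n + 1) contains a point of A at which the hypotheses
   hold but the integrals differ by at least e. *)
have pick (n : nat) : exists z, [/\ absC (z - z0) < n.+1%:R^-1, A z,
    measurable_fun I (k z), forall t, 0 <= t <= 1 -> `|k z t| <= dom t &
    e <= `|\int[mu]_(t in I) k0 t - \int[mu]_(t in I) k z t| ].
  apply: contrapT => nz; apply: nH.
  have n0 : (0 : R) < n.+1%:R^-1 by rewrite invr_gt0 ltr0n.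
  have := near_absC z0 n0; near_simpl => H.
  apply: filterS3 H mk kdom => z z1 z2 z3 Az.
  rewrite ltNge; apply/negP => ze; apply: nz; exists z; split => //; first exact: z2.
  exact: z3.
have [zs Hzs] := choice pick.
have zcvg : zs n @[n --> \oo] --> within A (nbhs z0).
  move=> P /nbhs_absCP [d d0 dP].
  have : \forall n \near \oo, n.+1%:R^-1 < d.
    exact: near_infty_natSinv_lt (PosNum d0).
  apply: filterS => n nd; have [z1 z2 _ _ _] := Hzs n.
  by apply: dP => //; exact: lt_trans z1 nd.
pose D := I `\ t0.
have mD : measurable D by exact: measurableD.
have mI : measurable I by [].
have pc t : D t -> k (zs n) t @[n --> \oo] --> k0 t.
  move=> [t01 tt0]; have h : 0 <= t <= 1 by move: t01; rewrite /= in_itv.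
  have tn : t != t0 by apply/eqP.
  exact: (cvg_comp _ _ zcvg (kk0 t h tn)).
have mkn n : measurable_fun I (k (zs n)) by case: (Hzs n).
(* k0 is a pointwise limit of measurable functions off t0; the single point is added back. *)
have mk0 : measurable_fun I k0.
  apply: (@measurable_funS _ _ _ _ (D `|` [set t0])).
  - exact: measurableU.
  - by move=> t tI; have [->|tt0] := eqVneq t t0; [right|left; split => //; apply/eqP].
  - apply/measurable_funU => //; split; last exact: measurable_fun_set1.
    apply: (@measurable_fun_cvg _ _ _ D (fun n => k (zs n))) => // n.
    by apply: (measurable_funS mI _ (mkn n)) => t [].
have ae1 : {ae mu, forall t, I t -> (EFin \o k (zs n)) t @[n --> \oo] --> (EFin \o k0) t}.
  exists [set t0]; split; [exact: measurable_set1|exact: lebesgue_measure_set1|].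
  move=> t /= nt; apply: contrapT => tt0; apply: nt => tI.
  by apply: cvg_EFin; [exact: nearW|exact: pc].
have ae2 : {ae mu, forall t n, I t -> (`|(EFin \o k (zs n)) t| <= (EFin \o dom) t)%E}.
  apply: aeW => t n tI; rewrite lee_fin; have [_ _ _ + _] := Hzs n; apply.
  by move: tI; rewrite /= in_itv.
have [ik0 _ ic] := @dominated_convergence _ _ R mu I mI
  (fun n => EFin \o k (zs n)) (EFin \o k0) (EFin \o dom)
  (fun n => proj2 (measurable_EFinP _ _) (mkn n)) (proj2 (measurable_EFinP _ _) mk0)
  ae1 idom ae2.
have fin0 : (\int[mu]_(t in I) (EFin \o k0) t)%E \is a fin_num by exact: integrable_fin_num.
rewrite -(fineK fin0) in ic.
have ic' : \int[mu]_(t in I) k (zs n) t @[n --> \oo] --> \int[mu]_(t in I) k0 t.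
  exact: fine_cvg ic.
move/cvgrPdist_lt: ic' => /(_ _ e0) [n _ /(_ n (leqnn n))] /=.
have [_ _ _ _ + h] := Hzs n.
by rewrite leNgt => /negP; apply.
Qed.

End RealIntegral.

Section PathIntegral.
Variable R : realType.
Local Notation mu := (@lebesgue_measure R).
Local Notation I := `[(0:R), 1]%classic.
Implicit Types (u v k : R -> Cx R).

(** [contour_integrable g f] is by conversion this property of [f (g t) * path_deriv g t], and
    [contour_int] is the matching [path_int] divided by 2 pi i. *)
Definition path_integrable u : Prop :=
  mu.-integrable I (fun t : R => (reC (u t))%:E) /\ mu.-integrable I (fun t : R => (imC (u t))%:E).

Definition path_int u : Cx R :=
  mkC (\int[mu]_(t in I) reC (u t)) (\int[mu]_(t in I) imC (u t)).

Let mI : measurable I := measurable_itv `[(0:R), 1].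

Lemma unit_integrable_ext (f h : R -> \bar R) : (forall t, 0 <= t <= 1 -> f t = h t) ->
  mu.-integrable I f -> mu.-integrable I h.
Proof.
move=> fh fi; apply: (@eq_integrable _ _ _ mu I mI f h _ fi).
by move=> t; rewrite inE /= in_itv /=; exact: fh.
Qed.

Lemma path_integrable_eq u v : (forall t, 0 <= t <= 1 -> u t = v t) ->
  path_integrable u -> path_integrable v.
Proof.
move=> uv [ui1 ui2]; split.
  by apply: unit_integrable_ext ui1 => t /uv ->.
by apply: unit_integrable_ext ui2 => t /uv ->.
Qed.

Lemma path_int_eq u v : (forall t, 0 <= t <= 1 -> u t = v t) -> path_int u = path_int v.
Proof.
by move=> uv; congr mkC; apply: eq_Rintegral => t; rewrite inE /= in_itv /= => /uv ->.
Qed.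

Lemma path_integrableD u v : path_integrable u -> path_integrable v ->
  path_integrable (fun t => u t + v t).
Proof.
move=> [u1 u2] [v1 v2]; split.
  refine (unit_integrable_ext _ (@integrableD _ _ R mu I mI _ _ u1 v1)) => t _.
  by rewrite reCD EFinD.
refine (unit_integrable_ext _ (@integrableD _ _ R mu I mI _ _ u2 v2)) => // t _.
by rewrite imCD EFinD.
Qed.

Lemma path_integrable_sum (T : Type) (r : seq T) (P : pred T) (u : T -> R -> Cx R) :
  (forall i, path_integrable (u i)) ->
  path_integrable (fun t => \sum_(i <- r | P i) u i t).
Proof.
move=> ui; elim: r => [|i r IH].
  under eq_fun do rewrite big_nil; split; exact: integrable0.
under eq_fun do rewrite big_cons.
by case: (P i); [exact: path_integrableD|exact: IH].
Qed.

Lemma real_integrable_mul (h u : R -> R) : {within I, continuous h} ->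
  mu.-integrable I (fun t : R => (u t)%:E) -> mu.-integrable I (fun t : R => (h t * u t)%:E).
Proof.
move=> hc ui.
have mh : measurable_fun I h by exact: subspace_continuous_measurable_fun.
have [c _ cM] : exists2 c, c \in `[(0:R), 1]%R &
    forall t, t \in `[(0:R), 1]%R -> `|h t| <= `|h c|.
  apply: (@EVT_max R (fun t => `|h t|) 0 1 ler01) => t.
  by apply: (continuous_comp (hc t)); exact: norm_continuous.
have bh : [bounded h x | x in I].
  exists `|h c|; split => [|M cMM t tI /=]; first exact: num_real.
  exact: le_trans (cM t tI) (ltW cMM).
by refine (unit_integrable_ext _ (@integrableMr _ _ R mu I mI _ _ mh bh ui)) => t _.
Qed.

Lemma path_integrable_mul k u :
  {within I, continuous (fun t => reC (k t))} ->
  {within I, continuous (fun t => imC (k t))} ->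
  path_integrable u -> path_integrable (fun t => k t * u t).
Proof.
move=> k1 k2 [u1 u2]; split.
  refine (unit_integrable_ext _ (@integrableB _ _ R mu I mI _ _ (real_integrable_mul k1 u1)
    (real_integrable_mul k2 u2))) => // t _.
  by rewrite reCM EFinB.
refine (unit_integrable_ext _ (@integrableD _ _ R mu I mI _ _ (real_integrable_mul k1 u2)
  (real_integrable_mul k2 u1))) => // t _.
by rewrite imCM EFinD.
Qed.

Lemma path_integrableZ (c : Cx R) u :
  path_integrable u -> path_integrable (fun t => c * u t).
Proof. by apply: path_integrable_mul; move=> t; exact: cvg_cst. Qed.

Lemma path_intD u v : path_integrable u -> path_integrable v ->
  path_int (fun t => u t + v t) = path_int u + path_int v.
Proof.
move=> [u1 u2] [v1 v2]; apply: Cx_eqP; rewrite ?reCD ?imCD /reC /imC /=.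
  rewrite -RintegralD //; by apply: eq_Rintegral => t _; rewrite -reCD.
rewrite -RintegralD //; by apply: eq_Rintegral => t _; rewrite -imCD.
Qed.

Lemma path_intZ (c : Cx R) u : path_integrable u ->
  path_int (fun t => c * u t) = c * path_int u.
Proof.
move=> [u1 u2].
have Zr (a : R) (f : R -> R) : mu.-integrable I (fun t : R => (f t)%:E) ->
    mu.-integrable I (fun t : R => (a * f t)%:E).
  by move=> fi; apply: real_integrable_mul => // t; exact: cvg_cst.
apply: Cx_eqP.
  rewrite reCM [LHS]/= /path_int /reC /imC /= -/(reC c) -/(imC c).
  rewrite -!RintegralZl // -RintegralB //; try exact: Zr.
  by apply: eq_Rintegral => t _; rewrite -reCM.
rewrite imCM [LHS]/= /path_int /reC /imC /= -/(reC c) -/(imC c).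
rewrite -!RintegralZl // -RintegralD //; try exact: Zr.
by apply: eq_Rintegral => t _; rewrite -imCM.
Qed.

Lemma path_integrable_abs u : path_integrable u ->
  mu.-integrable I (fun t : R => (`|reC (u t)| + `|imC (u t)|)%:E).
Proof.
move=> [u1 u2]; have i1 := integrable_norm u1; have i2 := integrable_norm u2.
refine (unit_integrable_ext _ (@integrableD _ _ R mu I mI _ _ i1 i2)) => // t _.
Qed.

(** The sum of absolute real and imaginary parts dominates the modulus and is visibly integrable;
    the factor 2 comes from bounding the two components of the integral separately. *)
Lemma absC_path_int_le u v (K : R) : path_integrable u -> path_integrable v ->
  (forall t, 0 <= t <= 1 -> absC (v t) <= K * absC (u t)) -> 0 <= K ->
  absC (path_int v) <= K * (2 * \int[mu]_(t in I) (`|reC (u t)| + `|imC (u t)|)).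
Proof.
move=> ui vi vu K0; have ai := path_integrable_abs ui.
have Kai : mu.-integrable I (fun t : R => (K * (`|reC (u t)| + `|imC (u t)|))%:E).
  by apply: real_integrable_mul => // t; exact: cvg_cst.
have le t : 0 <= t <= 1 -> absC (v t) <= K * (`|reC (u t)| + `|imC (u t)|).
  by move=> /vu h; apply: le_trans h _; rewrite ler_wpM2l // absC_le.
have b (f : R -> R) : mu.-integrable I (fun t : R => (f t)%:E) ->
    (forall t, 0 <= t <= 1 -> `|f t| <= K * (`|reC (u t)| + `|imC (u t)|)) ->
    `|\int[mu]_(t in I) f t| <= K * \int[mu]_(t in I) (`|reC (u t)| + `|imC (u t)|).
  move=> fi fle; apply: le_trans (le_normr_Rintegral _ fi) _ => //.
  rewrite -RintegralZl //; by apply: le_Rintegral => //; exact: integrable_norm fi.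
have [v1 v2] := vi.
apply: le_trans (absC_le _) _; rewrite mulrCA mulr_natl mulr2n lerD //.
  by apply: b => // t t01; apply: le_trans (reC_le _) (le t t01).
by apply: b => // t t01; apply: le_trans (imC_le _) (le t t01).
Qed.

Lemma path_int_cvg (A : set (Cx R)) (z0 : Cx R) (t0 : R)
    (k : Cx R -> R -> Cx R) (k0 : R -> Cx R) (dom : R -> R) :
  (\forall z \near z0, A z -> path_integrable (k z)) ->
  mu.-integrable I (EFin \o dom) ->
  (\forall z \near z0, A z -> forall t, 0 <= t <= 1 -> absC (k z t) <= dom t) ->
  (forall t, 0 <= t <= 1 -> t != t0 -> k z t @[z --> within A (nbhs z0)] --> k0 t) ->
  path_int (k z) @[z --> within A (nbhs z0)] --> path_int k0.
Proof.
move=> ki idom kdom kk0.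
have FF : Filter (within A (nbhs z0)) by apply: within_filter; exact: nbhs_filter.
have c1 : \int[mu]_(t in I) reC (k z t) @[z --> within A (nbhs z0)] -->
    \int[mu]_(t in I) reC (k0 t).
  apply: (@dominated_cvg_within R A z0 t0 (fun z t => reC (k z t)) _ dom) => //.
  - by apply: filterS ki => z H /H [/measurable_int /measurable_EFinP].
  - apply: filterS kdom => z H Az t t01; exact: le_trans (reC_le _) (H Az t t01).
  - move=> t t01 tt0; exact: (cvg_comp _ _ (kk0 t t01 tt0) (@continuous_reC R (k0 t))).
have c2 : \int[mu]_(t in I) imC (k z t) @[z --> within A (nbhs z0)] -->
    \int[mu]_(t in I) imC (k0 t).
  apply: (@dominated_cvg_within R A z0 t0 (fun z t => imC (k z t)) _ dom) => //.
  - by apply: filterS ki => z H /H [_ /measurable_int /measurable_EFinP].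
  - apply: filterS kdom => z H Az t t01; exact: le_trans (imC_le _) (H Az t t01).
  - move=> t t01 tt0; exact: (cvg_comp _ _ (kk0 t t01 tt0) (@continuous_imC R (k0 t))).
apply/(cvg_absCP FF) => e e0; have e2 : 0 < e / 2 by rewrite divr_gt0.
move/(@cvgrPdist_lt _ _ _ _ FF): c1 => /(_ _ e2) H1.
move/(@cvgrPdist_lt _ _ _ _ FF): c2 => /(_ _ e2) H2.
apply: filterS2 H1 H2 => z; rewrite distrC => h1; rewrite distrC => h2.
apply: le_lt_trans (absC_le _) _; rewrite reCB imCB [e]splitr.
exact: ltrD.
Qed.

End PathIntegral.

(** * Cauchy integrals *)

Lemma cvg_within_eq (T U : topologicalType) (A : set T) (z : T) (f h : T -> U) (l : U) :
  (forall x, A x -> f x = h x) ->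
  f @ within A (nbhs z) --> l -> h @ within A (nbhs z) --> l.
Proof.
move=> fh fl P /fl /= HP.
have : \forall x \near z, A x -> P (f x) by exact: HP.
by apply: filterS => x Hx Ax /=; rewrite -fh //; apply: Hx.
Qed.

Section CauchyTransform.
Variables (R : realType) (g : R -> Cx R).
Hypothesis g_cont : {within `[0, 1], continuous g}.
Hypothesis g_C1 : piecewise_C1 g.
Local Notation mu := (@lebesgue_measure R).
Local Notation I := `[(0:R), 1]%classic.
Implicit Types (f G : Cx R -> Cx R) (z w : Cx R).

Lemma path_integrable_loop_mul (k : Cx R -> Cx R) (u : R -> Cx R) :
  (forall w, loop_set g w -> {for w, continuous k}) ->
  path_integrable u -> path_integrable (fun t => k (g t) * u t).
Proof.
move=> kc; apply: path_integrable_mul.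
  apply: (within_loop_comp g_cont (h := fun w => reC (k w))) => t t01.
  apply: (cvg_comp _ _ (kc (g t) _) (@continuous_reC R (k (g t)))).
  by exists t => //; rewrite /= in_itv.
apply: (within_loop_comp g_cont (h := fun w => imC (k w))) => t t01.
apply: (cvg_comp _ _ (kc (g t) _) (@continuous_imC R (k (g t)))).
by exists t => //; rewrite /= in_itv.
Qed.

Lemma derivable_inv_sub (z w : Cx R) : w != z -> derivable (fun v => (v - z)^-1) w 1.
Proof.
move=> wz; apply: derivable_inv; first by rewrite subr_eq0.
have := is_derive_add (is_derive_ident w) (is_derive_const (- z) w).
exact: is_derive_derivable.
Qed.

Lemma continuous_inv_loop z : ~ loop_set g z ->
  forall w, loop_set g w -> {for w, continuous (fun w => (w - z)^-1)}.
Proof.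
move=> zl w wl; apply: derivable_cvg; apply: derivable_inv_sub.
by apply/eqP => wz; apply: zl; rewrite -wz.
Qed.

Lemma path_integrable_deriv : path_integrable (path_deriv g).
Proof.
have [m1 m2 [M M0 HM]] := path_deriv_measurable_bounded g_C1.
have mI : measurable I by exact: measurable_itv.
have Ifin : (mu I < +oo)%E by rewrite /= lebesgue_measure_itv /= lte01 oppr0 adde0 ltry.
split; apply: measurable_bounded_integrable => //.
  exists M; split => [|x Mx t tI /=]; first exact: num_real.
  by apply: le_trans (reC_le _) (le_trans (HM t tI) (ltW Mx)).
exists M; split => [|x Mx t tI /=]; first exact: num_real.
by apply: le_trans (imC_le _) (le_trans (HM t tI) (ltW Mx)).
Qed.

Lemma Cauchy_integrable f z : ~ loop_set g z -> contour_integrable g f ->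
  path_integrable (fun t => (g t - z)^-1 * (f (g t) * path_deriv g t)).
Proof.
move=> zl fi.
exact: (@path_integrable_loop_mul (fun w => (w - z)^-1) _ (continuous_inv_loop zl) fi).
Qed.

(** With a = w - z, the identity [1/(a - h) - 1/a - h/a^2 = h^2/((a - h) a^2)] gives an explicit
    remainder, quadratic in h, so no limit is taken under the integral. *)
Lemma derivable_Cauchy f z : ~ loop_set g z -> contour_integrable g f ->
  derivable (fun v => contour_int g (fun w => (w - v)^-1 * f w)) z 1.
Proof.
move=> zl fi; pose u t := f (g t) * path_deriv g t.
pose c : Cx R := mkC 0 (2 * pi).
pose D := path_int (fun t => (g t - z)^-1 * ((g t - z)^-1 * u t)).
have [d d0 Hd] := loop_dist g_cont zl.
pose X := 2 * \int[mu]_(t in I) (`|reC (u t)| + `|imC (u t)|).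
have X0 : 0 <= X by rewrite mulr_ge0 // Rintegral_ge0 // => t _; rewrite addr_ge0.
apply: (@is_derive_derivable _ _ _ (D / c)); apply/is_derive_absCP => e e0.
(* The kernel is at most (2/d)(1/d)(1/d), X bounds the integral of u, and the last factor is the
   division by 2 pi i. *)
pose B := 2 / d ^+ 3 * X * absC c^-1.
have d3 : 0 <= 2 / d ^+ 3 by rewrite divr_ge0 // exprn_ge0 // ltW.
have B0 : 0 <= B by rewrite /B mulr_ge0 ?absC_ge0 // mulr_ge0.
have e1 : 0 < e / (B + 1) by rewrite divr_gt0 // ltr_wpDl.
have zi := Cauchy_integrable zl fi.
have zi2 : path_integrable (fun t => (g t - z)^-1 * ((g t - z)^-1 * u t)).
  exact: (@path_integrable_loop_mul (fun w => (w - z)^-1) _ (continuous_inv_loop zl) zi).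
have d2 : 0 < d / 2 by rewrite divr_gt0.
(* d / 2 keeps z + h at distance d / 2 from the loop; the other bound makes [absC h * B] at most e,
   B + 1 being positive. *)
apply/nbhs_absCP; exists (Num.min (d / 2) (e / (B + 1))); first by rewrite lt_min d2.
move=> h; rewrite subr0 lt_min => /andP[hd he].
have dzh t : 0 <= t <= 1 -> d / 2 <= absC (g t - (z + h)).
  move=> /Hd; have := absCB_ge (g t - z) h; rewrite opprD addrA; lra.
have zhl : ~ loop_set g (z + h).
  move=> [t t01 te]; have := dzh t; rewrite te subrr absC0.
  by move: t01; rewrite /= in_itv /= => -> /(_ isT); lra.
have zhi := Cauchy_integrable zhl fi.
have diff : contour_int g (fun w => (w - (z + h))^-1 * f w)
    - contour_int g (fun w => (w - z)^-1 * f w) - D / c * h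
  = path_int (fun t => h ^+ 2 * ((g t - (z + h))^-1 * ((g t - z)^-1 * ((g t - z)^-1 * u t)))) / c.
  have cE v : contour_int g (fun w => (w - v)^-1 * f w) =
      path_int (fun t => (g t - v)^-1 * u t) / c.
    by congr (_ / _); apply: path_int_eq => t _; rewrite mulrA.
  rewrite !cE /D -!mulrBl mulrAC -mulrBl; congr (_ / _).
  pose q t := (g t - (z + h))^-1 * u t + ((-1) * ((g t - z)^-1 * u t)
    + (- h) * ((g t - z)^-1 * ((g t - z)^-1 * u t))).
  have -> : path_int (fun t => h ^+ 2 * ((g t - (z + h))^-1 *
      ((g t - z)^-1 * ((g t - z)^-1 * u t)))) = path_int q.
    apply: path_int_eq => t t01; rewrite /q.
    have a0 : g t - z != 0.
      by rewrite -absC_gt0; apply: lt_le_trans d0 (Hd t t01).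
    have b0 : g t - (z + h) != 0 by rewrite -absC_gt0; apply: lt_le_trans d2 (dzh t t01).
    by field; rewrite a0 b0.
  have i1 := path_integrableZ (-1) zi; have i2 := path_integrableZ (- h) zi2.
  rewrite /q (path_intD zhi (path_integrableD i1 i2)) (path_intD i1 i2).
  by rewrite (path_intZ _ zi) (path_intZ _ zi2); ring.
pose v t := h ^+ 2 * ((g t - (z + h))^-1 * ((g t - z)^-1 * ((g t - z)^-1 * u t))).
have vi : path_integrable v.
  exact: path_integrableZ (@path_integrable_loop_mul (fun w => (w - (z + h))^-1) _
    (continuous_inv_loop zhl) zi2).
have vle t : 0 <= t <= 1 -> absC (v t) <= (absC h ^+ 2 * (2 / d ^+ 3)) * absC (u t).
  move=> t01; rewrite /v absCM absCX -mulrA ler_wpM2l ?exprn_ge0 ?absC_ge0 //.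
  rewrite (absCM (g t - (z + h))^-1) (absCM (g t - z)^-1 (_ * _)).
  rewrite (absCM (g t - z)^-1 (u t)) !absCV.
  have k1 : (absC (g t - z))^-1 <= d^-1.
    by rewrite lef_pV2 ?posrE // ?Hd // (lt_le_trans d0) ?Hd.
  have k2 : (absC (g t - (z + h)))^-1 <= (d / 2)^-1.
    by rewrite lef_pV2 ?posrE // ?dzh // (lt_le_trans d2) ?dzh.
  have n0 (x : Cx R) : 0 <= (absC x)^-1 by rewrite invr_ge0 absC_ge0.
  have -> : 2 / d ^+ 3 * absC (u t) = (d / 2)^-1 * (d^-1 * (d^-1 * absC (u t))).
    by field; rewrite lt0r_neq0.
  by do 3 (apply: ler_pM => //; rewrite ?mulr_ge0 ?absC_ge0 //).
have K0 : 0 <= absC h ^+ 2 * (2 / d ^+ 3).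
  by rewrite mulr_ge0 // exprn_ge0 // absC_ge0.
have := absC_path_int_le fi vi vle K0; rewrite -/X => le.
rewrite diff absCM -/v.
apply: (@le_trans _ _ (absC h * (absC h * B))).
  apply: le_trans (ler_wpM2r (absC_ge0 _) le) _.
  by rewrite /B [leRHS](_ : _ = absC h ^+ 2 * (2 / d ^+ 3) * X * absC c^-1) //; ring.
rewrite mulrC ler_wpM2r ?absC_ge0 //.
move: he; rewrite ltr_pdivlMr ?ltr_wpDl //; have := absC_ge0 h; lra.
Qed.

Hypothesis g1 : g 1 = 0.
Hypothesis g_inj : {in `[0, 1[ &, injective g}.

(* Where f is the trace of G, the Cauchy integral of f is
   [G z * winding g z] plus the integral of (f w - G z) / (w - z), whose
   integrand stays bounded as z tends to a point near which G is Lipschitz. *)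
Lemma Cauchy_jump f G z0 : contour_integrable g f -> jump_set g z0 ->
  locally_lipschitz G z0 -> (forall w, jump_set g w -> f w = G w) ->
  let Q v := contour_int g (fun w => (w - v)^-1 * f w) in
  exists H : Cx R, Q z @[z --> within (plus_side g) (nbhs z0)] --> H /\
    Q z @[z --> within (minus_side g) (nbhs z0)] --> H - G z0.
Proof.
move=> fi [[t0 t001 gt0] z00] GL fG Q.
have {}z00 : z0 != 0 by apply/eqP.
have Gc := locally_lipschitz_cvg GL.
have [L [r [L0 r0 HL]]] := GL.
have [_ _ [M M0 HM]] := path_deriv_measurable_bounded g_C1.
pose c : Cx R := mkC 0 (2 * pi).
pose k z t := (g t - z)^-1 * ((f (g t) - G z) * path_deriv g t).
pose u t := f (g t) * path_deriv g t.
pose D := ~` loop_set g.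
have ki z : D z -> path_integrable (k z).
  move=> zl; have := path_integrableD (Cauchy_integrable zl fi)
    (path_integrableZ (- G z) (@path_integrable_loop_mul (fun w => (w - z)^-1) _
    (continuous_inv_loop zl) path_integrable_deriv)).
  apply: path_integrable_eq => t _; rewrite /k; ring.
have QE z : D z -> Q z = path_int (k z) / c + G z * winding g z.
  move=> zl; have i1 := Cauchy_integrable zl fi.
  have i2 := @path_integrable_loop_mul (fun w => (w - z)^-1) _
    (continuous_inv_loop zl) path_integrable_deriv.
  have -> : Q z = path_int (fun t => (g t - z)^-1 * (f (g t) * path_deriv g t)) / c.
    by congr (_ / _); apply: path_int_eq => t _; rewrite mulrA.
  have -> : winding g z = path_int (fun t => (g t - z)^-1 * path_deriv g t) / c by [].
  rewrite mulrA -mulrDl -path_intZ // -path_intD //; last exact: path_integrableZ.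
    by congr (_ / _); apply: path_int_eq => t _; rewrite /k; ring.
  exact: ki.
(* Within s of z0 the Lipschitz bound holds and the loop avoids 0, so f equals G there. *)
pose s := Num.min r (absC z0).
have s0 : 0 < s by rewrite lt_min r0 absC_gt0.
pose C0 := absC (G z0) + L * r.
have C00 : 0 <= C0 by rewrite addr_ge0 ?absC_ge0 // mulr_ge0 // ltW.
(* Near z0 the difference quotient is at most L and the speed at most M. Far from z0 the kernel is
   at most 2 / s, and C0 bounds G(z). *)
pose dom t := L * M + 2 / s * (`|reC (u t)| + `|imC (u t)| + C0 * M).
have domi : mu.-integrable I (EFin \o dom).
  have cst (a : R) : mu.-integrable I (EFin \o cst a).
    by apply: continuous_compact_integrable; [exact: segment_compact|move=> x; exact: cvg_cst].
  have mI : measurable I by exact: measurable_itv.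
  have i1 := @integrableD _ _ R mu I mI _ _ (path_integrable_abs fi) (cst (C0 * M)).
  have i2 : mu.-integrable I (fun t : R => (2 / s * (`|reC (u t)| + `|imC (u t)| + C0 * M))%:E).
    apply: real_integrable_mul; first by move=> x; exact: cvg_cst.
    by apply: unit_integrable_ext i1 => t _; rewrite /= EFinD.
  have i3 := @integrableD _ _ R mu I mI _ _ (cst (L * M)) i2.
  by apply: unit_integrable_ext i3 => t _; rewrite /= -EFinD.
have kdom : \forall z \near z0, D z -> forall t, 0 <= t <= 1 -> absC (k z t) <= dom t.
  (* For such z, a loop point at distance at least s from z0 is at distance at least s / 2 from
     z. *)
  apply/nbhs_absCP; exists (s / 2); first by rewrite divr_gt0.
  move=> z zs zl t t01.
  have zr : absC (z - z0) < r.
    have : s <= r by rewrite ge_min lexx.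
    lra.
  have zr0 : absC (z0 - z0) < r by rewrite subrr absC0.
  have gz0 : 0 < absC (g t - z).
    rewrite absC_gt0 subr_eq0; apply/eqP => gz; by apply: zl; exists t.
  have p1 : 0 <= L * M by rewrite mulr_ge0.
  have p2 : 0 <= `|reC (u t)| + `|imC (u t)| + C0 * M by rewrite !addr_ge0 // mulr_ge0.
  have [near_t|far_t] := ltP (absC (g t - z0)) s.
    have gr : absC (g t - z0) < r by move: near_t; rewrite lt_min => /andP[].
    have gn0 : g t != 0.
      apply/eqP => e; move: near_t; rewrite e sub0r absCN lt_min ltxx andbF //.
    rewrite /k fG; last first.
      by split; [exists t|apply/eqP].
    apply: (@le_trans _ _ (L * M)); last by rewrite lerDl mulr_ge0 // divr_ge0 // ltW.
    rewrite absCM absCV ler_pdivrMl // absCM mulrCA mulrA.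
    by apply: ler_pM; rewrite ?absC_ge0 ?HM // HL.
  have far : s / 2 <= absC (g t - z).
    have := absCD (g t - z) (z - z0); rewrite addrA subrK; lra.
  apply: (@le_trans _ _ (2 / s * (`|reC (u t)| + `|imC (u t)| + C0 * M))); last by rewrite lerDr.
  have -> : 2 / s = (s / 2)^-1 by rewrite invf_div.
  rewrite /k absCM absCV; apply: ler_pM; rewrite ?absC_ge0 ?invr_ge0 ?absC_ge0 //.
    by rewrite lef_pV2 ?posrE // divr_gt0.
  have -> : (f (g t) - G z) * path_deriv g t = u t + (- G z) * path_deriv g t by rewrite /u; ring.
  apply: le_trans (absCD _ _) _; rewrite lerD ?absC_le // absCM absCN.
  apply: ler_pM; rewrite ?absC_ge0 ?HM //.
  have := absCD (G z - G z0) (G z0); rewrite subrK /C0.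
  have := HL z z0 zr zr0; have : L * absC (z - z0) <= L * r by rewrite ler_wpM2l // ltW.
  lra.
have t0lt : t0 < 1.
  move: t001; rewrite /= in_itv /= => /andP[_]; rewrite le_eqVlt => /orP[/eqP t1|//].
  by move: z00; rewrite -gt0 t1 g1 eqxx.
(* By injectivity t0 is the only parameter of z0 in [0, 1[, and t = 1 gives the origin; so the
   kernel has no pole at any other t. *)
have kc t : 0 <= t <= 1 -> t != t0 -> k z t @[z --> within D (nbhs z0)] --> k z0 t.
  move=> t01 tt0.
  have gz : g t != z0.
    apply/eqP => e; have [t1|tn1] := eqVneq t 1.
      by move: z00; rewrite -e t1 g1 eqxx.
    case/eqP: tt0; apply: g_inj; rewrite ?e ?gt0 // in_itv /=.
      by move: t01 => /andP[-> t1]; rewrite lt_def eq_sym tn1.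
    by move: t001; rewrite /= in_itv /= => /andP[->].
  apply: cvg_within_filter.
  have c1 : (g t - z)^-1 @[z --> z0] --> (g t - z0)^-1.
    apply: (@derivable_cvg _ (fun z => (g t - z)^-1)); apply: derivable_inv.
      by rewrite subr_eq0.
    have := is_derive_add (is_derive_const (g t) z0) (is_derive_opp (is_derive_ident z0)).
    exact: is_derive_derivable.
  apply: cvgM; first exact: c1.
  by apply: cvgM; [apply: cvgB; [exact: cvg_cst|exact: Gc]|exact: cvg_cst].
have kint := @path_int_cvg R D z0 t0 k (k z0) dom
  (filterS (fun z _ => @ki z) (filterT : nbhs z0 setT)) domi kdom kc.
(* The integral has the same limit from anywhere off the loop; the sides differ only by the winding
   number, 0 or -1, that multiplies G(z). *)
exists (path_int (k z0) / c).
have FF : Filter (within D (nbhs z0)) by apply: within_filter; exact: nbhs_filter.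
have kintc : path_int (k z) / c @[z --> within D (nbhs z0)] --> path_int (k z0) / c.
  by apply: cvgM; [exact: kint|exact: cvg_cst].
have sub A : A `<=` D -> within A (nbhs z0) --> within D (nbhs z0).
  move=> AD P /= PD; have := PD : \forall z \near z0, D z -> P z.
  by apply: filterS => z H /AD /H.
split.
  have pD : plus_side g `<=` D by move=> z [].
  apply: cvg_within_eq (cvg_trans (cvg_app _ (sub _ pD)) kintc) => z [zl w0].
  by rewrite QE // w0 mulr0 addr0.
have pD : minus_side g `<=` D by move=> z [].
have FF' : Filter (within (minus_side g) (nbhs z0)) by apply: within_filter; exact: nbhs_filter.
have : path_int (k z) / c - G z @[z --> within (minus_side g) (nbhs z0)] -->
    path_int (k z0) / c - G z0.
  apply: cvgB; last exact: cvg_within_filter Gc.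
  exact: cvg_trans (cvg_app _ (sub _ pD)) kintc.
apply: cvg_within_eq => z [zl w0].
by rewrite QE // w0 mulrN1.
Qed.

End CauchyTransform.

(** * Matrix Cauchy integrals *)

Section MatrixLimits.
Variables (R : realType) (T : Type) (F : set_system T).
Context {FF : Filter F}.

Lemma cvg_bigsum (I : Type) (r : seq I) (P : pred I) (f : I -> T -> Cx R) (l : I -> Cx R) :
  (forall i, f i x @[x --> F] --> l i) ->
  \sum_(i <- r | P i) f i x @[x --> F] --> \sum_(i <- r | P i) l i.
Proof.
move=> fl; elim: r => [|i r IH].
  under eq_fun do rewrite big_nil; rewrite big_nil; exact: cvg_cst.
under eq_fun do rewrite big_cons; rewrite big_cons.
by case: (P i); [apply: cvgD; [exact: fl|exact: IH]|exact: IH].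
Qed.

Lemma cvg_bigprod (I : Type) (r : seq I) (P : pred I) (f : I -> T -> Cx R) (l : I -> Cx R) :
  (forall i, f i x @[x --> F] --> l i) ->
  \prod_(i <- r | P i) f i x @[x --> F] --> \prod_(i <- r | P i) l i.
Proof.
move=> fl; elim: r => [|i r IH].
  under eq_fun do rewrite big_nil; rewrite big_nil; exact: cvg_cst.
under eq_fun do rewrite big_cons; rewrite big_cons.
by case: (P i); [apply: cvgM; [exact: fl|exact: IH]|exact: IH].
Qed.

Lemma cvg_mulmx m n p (f : T -> 'M[Cx R]_(m, n)) (h : T -> 'M[Cx R]_(n, p))
    (A : 'M[Cx R]_(m, n)) (B : 'M[Cx R]_(n, p)) :
  f @ F --> A -> h @ F --> B -> f x *m h x @[x --> F] --> A *m B.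
Proof.
move=> /cvg_mxP fA /cvg_mxP hB; apply/cvg_mxP => i j; rewrite mxE.
under eq_fun do rewrite mxE.
by apply: cvg_bigsum => k; apply: cvgM; [exact: fA|exact: hB].
Qed.

Lemma cvg_oppmx m n (f : T -> 'M[Cx R]_(m, n)) (A : 'M[Cx R]_(m, n)) :
  f @ F --> A -> - f x @[x --> F] --> - A.
Proof.
move=> /cvg_mxP fA; apply/cvg_mxP => i j; rewrite mxE.
under eq_fun do rewrite mxE.
by apply: cvgN; exact: fA.
Qed.

Lemma cvg_block_mx m1 m2 n1 n2 (f1 : T -> 'M[Cx R]_(m1, n1)) (f2 : T -> 'M[Cx R]_(m1, n2))
    (f3 : T -> 'M[Cx R]_(m2, n1)) (f4 : T -> 'M[Cx R]_(m2, n2))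
    (A1 : 'M[Cx R]_(m1, n1)) (A2 : 'M[Cx R]_(m1, n2))
    (A3 : 'M[Cx R]_(m2, n1)) (A4 : 'M[Cx R]_(m2, n2)) :
  f1 @ F --> A1 -> f2 @ F --> A2 -> f3 @ F --> A3 -> f4 @ F --> A4 ->
  block_mx (f1 x) (f2 x) (f3 x) (f4 x) @[x --> F] --> block_mx A1 A2 A3 A4.
Proof.
move=> /cvg_mxP c1 /cvg_mxP c2 /cvg_mxP c3 /cvg_mxP c4; apply/cvg_mxP => i j.
case: (split_ordP i) => i' ->; case: (split_ordP j) => j' ->.
- by rewrite block_mxEul; under eq_fun do rewrite block_mxEul; exact: c1.
- by rewrite block_mxEur; under eq_fun do rewrite block_mxEur; exact: c2.
- by rewrite block_mxEdl; under eq_fun do rewrite block_mxEdl; exact: c3.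
- by rewrite block_mxEdr; under eq_fun do rewrite block_mxEdr; exact: c4.
Qed.

Lemma cvg_det n (f : T -> 'M[Cx R]_n) (A : 'M[Cx R]_n) :
  f @ F --> A -> \det (f x) @[x --> F] --> \det A.
Proof.
move=> /cvg_mxP fA; apply: cvg_bigsum => s; apply: cvgM; first exact: cvg_cst.
by apply: cvg_bigprod => i; exact: fA.
Qed.

Lemma cvg_invmx n (f : T -> 'M[Cx R]_n) (A : 'M[Cx R]_n) :
  (forall x, f x \in unitmx) -> A \in unitmx ->
  f @ F --> A -> invmx (f x) @[x --> F] --> invmx A.
Proof.
move=> fu Au fA; apply/cvg_mxP => i j.
under eq_fun do rewrite /invmx fu mxE mxE.
rewrite /invmx Au mxE mxE; apply: cvgM.
  by apply: cvgV; [rewrite -unitfE -unitmxE|exact: cvg_det].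
apply: cvgM; first exact: cvg_cst.
apply: cvg_det; apply/cvg_mxP => a b; rewrite !mxE; under eq_fun do rewrite !mxE.
by move/cvg_mxP: fA; apply.
Qed.

End MatrixLimits.

Section CauchyMatrix.
Variables (R : realType) (N : nat) (g : R -> Cx R).
Hypothesis hg : loop_around_infinity g.
Implicit Types (W P E : Cx R -> 'M[Cx R]_N) (z : Cx R).

Definition Cauchy_mx W z : 'M[Cx R]_N := mx_contour_int g (fun w => (w - z)^-1 *: W w).

Definition has_jump (Q : Cx R -> 'M[Cx R]_N) z (J : 'M[Cx R]_N) : Prop :=
  exists A, bdry_plus g Q z A /\ bdry_minus g Q z (A - J).

Lemma Cauchy_mxE W i j : (fun v => Cauchy_mx W v i j) =
  (fun v => contour_int g (fun w => (w - v)^-1 * W w i j)).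
Proof.
apply/funext => v; rewrite mxE.
by congr contour_int; apply/funext => w; rewrite mxE.
Qed.

Lemma Cauchy_mx_derivable W z : ~ loop_set g z ->
  (forall i j, contour_integrable g (fun w => W w i j)) -> mx_derivable (Cauchy_mx W) z.
Proof.
have [gc gC1 _ _ _] := hg; move=> zl Wi i j.
rewrite Cauchy_mxE; exact: (@derivable_Cauchy R g gc (fun w => W w i j) z zl (Wi i j)).
Qed.

Lemma Cauchy_mx_jump W E z :
  (forall i j, contour_integrable g (fun w => W w i j)) -> jump_set g z ->
  (forall i j, locally_lipschitz (fun w => E w i j) z) ->
  (forall w, jump_set g w -> W w = E w) -> has_jump (Cauchy_mx W) z (E z).
Proof.
have [gc gC1 [_ g1] ginj _] := hg; move=> Wi jz El WE.
have pick (ij : 'I_N * 'I_N) : exists H : Cx R,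
    (fun v => Cauchy_mx W v ij.1 ij.2) @ within (plus_side g) (nbhs z) --> H /\
    (fun v => Cauchy_mx W v ij.1 ij.2) @ within (minus_side g) (nbhs z) --> H - E z ij.1 ij.2.
  rewrite Cauchy_mxE.
  apply: (@Cauchy_jump R g gc gC1 g1 ginj _ (fun w => E w ij.1 ij.2)) => //.
  by move=> w jw; rewrite WE.
have [H HH] := choice pick.
have FP A : Filter (within A (nbhs z)) by apply: within_filter; exact: nbhs_filter.
exists (\matrix_(i, j) H (i, j)); split.
  apply/(cvg_mxP (FP _)) => i j; have [h _] := HH (i, j).
  by rewrite mxE; exact: h.
apply/(cvg_mxP (FP _)) => i j; have [_ h] := HH (i, j).
by rewrite !mxE; exact: h.
Qed.

(** Covers index -1, where Q is a constant matrix and P vanishes, so that the jump P W is 0. *)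
Lemma has_jump_const (A : 'M[Cx R]_N) z : has_jump (fun=> A) z 0.
Proof. by exists A; rewrite subr0; split; exact: cvg_cst. Qed.

Lemma has_jump_mull (A : 'M[Cx R]_N) Q z J :
  has_jump Q z J -> has_jump (fun w => A *m Q w) z (A *m J).
Proof.
move=> [H [H1 H2]]; exists (A *m H); rewrite -mulmxBr.
have FP D : Filter (within D (nbhs z)) by apply: within_filter; exact: nbhs_filter.
split; apply: (@cvg_mulmx _ _ _ (FP _)); [exact: cvg_cst|exact: H1|exact: cvg_cst|exact: H2].
Qed.

Lemma has_jump_mulr (A : 'M[Cx R]_N) Q z J :
  has_jump Q z J -> has_jump (fun w => Q w *m A) z (J *m A).
Proof.
move=> [H [H1 H2]]; exists (H *m A); rewrite -mulmxBl.
have FP D : Filter (within D (nbhs z)) by apply: within_filter; exact: nbhs_filter.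
split; apply: (@cvg_mulmx _ _ _ (FP _)); [exact: H1|exact: cvg_cst|exact: H2|exact: cvg_cst].
Qed.

Lemma has_jump_opp Q z J : has_jump Q z J -> has_jump (fun w => - Q w) z (- J).
Proof.
move=> [H [H1 H2]]; exists (- H); have -> : - H - - J = - (H - J) by rewrite opprD.
have FP D : Filter (within D (nbhs z)) by apply: within_filter; exact: nbhs_filter.
split; apply: (@cvg_oppmx _ _ _ (FP _)); [exact: H1|exact: H2].
Qed.

End CauchyMatrix.

(** Here a and b are the boundary values of W_L and W_R. The jump p a b of q, multiplied by b^-1,
    becomes p a, the first block column, which the unipotent factor adds back. *)
Lemma jump_block_left (K : comUnitRingType) N (p1 q1 p2 q2 a b : 'M[K]_N) : b \in unitmx ->
  block_mx p1 q1 p2 q2 *m block_mx a 0 0 (invmx b) =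
  block_mx p1 (q1 - p1 *m (a *m b)) p2 (q2 - p2 *m (a *m b)) *m block_mx a 0 0 (invmx b)
    *m block_mx 1%:M 1%:M 0 1%:M.
Proof.
move=> bu; rewrite !mulmx_block !(mulmx0, mulmx1, addr0, add0r) !mulmxBl.
by rewrite -!mulmxA (mulmxV bu) mulmx1 ![_ *m a + _]addrC !subrK.
Qed.

(** The mirror image: a^-1 (a b) p = b p is the first block row. *)
Lemma jump_block_right (K : comUnitRingType) N (p1 q1 p2 q2 a b : 'M[K]_N) : a \in unitmx ->
  block_mx b 0 0 (invmx a) *m block_mx p1 p2 q1 q2 =
  block_mx 1%:M 0 1%:M 1%:M *m (block_mx b 0 0 (invmx a) *m
    block_mx p1 p2 (q1 - (a *m b) *m p1) (q2 - (a *m b) *m p2)).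
Proof.
move=> au; rewrite !mulmx_block !(mul0mx, mul1mx, addr0, add0r) !mulmxBr.
by rewrite !mulmxA (mulVmx au) mul1mx ![b *m _ + _]addrC !subrK.
Qed.

(** * Integrability and logarithms for the second kind functions *)

Section SecondKindFunctions.
Variables (R : realType) (N : nat) (g : R -> Cx R).
Hypothesis hg : loop_around_infinity g.
Implicit Types (W : Cx R -> 'M[Cx R]_N) (z : Cx R) (P : 'M[{poly Cx R}]_N).

Lemma mxeval_derivable P z : mx_derivable (mxeval P) z.
Proof. move=> i j; under eq_fun do rewrite mxE; exact: derivable_poly. Qed.

Lemma mxeval_lipschitz P z i j : locally_lipschitz (fun w => mxeval P w i j) z.
Proof. under eq_fun do rewrite mxE; exact: locally_lipschitz_horner. Qed.

Lemma locally_lipschitz_mulmx W W' z :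
  (forall i j, locally_lipschitz (fun w => W w i j) z) ->
  (forall i j, locally_lipschitz (fun w => W' w i j) z) ->
  forall i j, locally_lipschitz (fun w => (W w *m W' w) i j) z.
Proof.
move=> Wl Wl' i j; under eq_fun do rewrite mxE.
apply: locally_lipschitz_sum => k; exact: locally_lipschitz_mul.
Qed.

(** The zeroth moment makes the entries of W integrable along the loop, where a polynomial is
    continuous and hence bounded. *)
Lemma moments_integrable W P i j k l : moments_exist g W ->
  contour_integrable g (fun w => mxeval P w i j * W w k l).
Proof.
have [gc _ _ _ _] := hg; move=> Wm.
have W0 : path_integrable (fun t => W (g t) k l * path_deriv g t).
  apply: path_integrable_eq (Wm 0%N k l) => t _; by rewrite expr0 mul1r.
have pc w : loop_set g w -> {for w, continuous (fun w => mxeval P w i j)}.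
  by move=> _; exact: (@derivable_cvg R (fun w => mxeval P w i j) w (@mxeval_derivable P w i j)).
apply: path_integrable_eq (@path_integrable_loop_mul R g gc _ _ pc W0) => t _.
by rewrite mulrA.
Qed.

Lemma QL_integrable W P i j : moments_exist g W ->
  contour_integrable g (fun w => (mxeval P w *m W w) i j).
Proof.
move=> Wm; apply: path_integrable_eq (path_integrable_sum (index_enum 'I_N) xpredT
  (fun k => moments_integrable P i k k j Wm)) => t _.
by rewrite mxE mulr_suml.
Qed.

Lemma QR_integrable W P i j : moments_exist g W ->
  contour_integrable g (fun w => (W w *m mxeval P w) i j).
Proof.
move=> Wm; apply: path_integrable_eq (path_integrable_sum (index_enum 'I_N) xpredT
  (fun k => moments_integrable P k j i k Wm)) => t _.
by rewrite mxE mulr_suml; apply: eq_bigr => k _; rewrite [W _ _ _ * _]mulrC.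
Qed.

Lemma jump_set_cexp W z : bessel_type g W -> jump_set g z -> exists s, cexp s = z.
Proof.
have [_ _ [g0 g1] _ _] := hg.
move=> [ell [He _]] [[t + gt] z0]; rewrite /= in_itv /= => /andP[t0 t1].
exists (ell t); rewrite -gt; apply: (He t _).2.
(* The Bessel logarithm exists on the open parameter interval; both ends map to 0, which [jump_set]
   excludes. *)
rewrite !lt_neqAle t0 t1 !andbT; apply/andP; split; apply/eqP => e; apply: z0.
  by rewrite /= -gt -e g0.
by rewrite /= -gt e g1.
Qed.

End SecondKindFunctions.

Theorem theorem2 (R : realType) (N : nat) (hN : (1 <= N)%N)
  (g : R -> Cx R) (hg : loop_around_infinity g)
  (W WL WR hL hR : Cx R -> 'M[Cx R]_N)
  (W_bessel : bessel_type g W) (W_moments : moments_exist g W)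
  (W_regular : regular g W)
  (hL_entire : mx_holomorphic_on setT hL)
  (hR_entire : mx_holomorphic_on setT hR)
  (WL_sol : left_solution g hL WL) (WR_sol : right_solution g hR WR)
  (W_fact : factorizes g W WL WR)
  (CL CR : 'M[Cx R]_N)
  (hCL : forall z, jump_set g z -> forall A B : 'M[Cx R]_N,
     bdry_plus g WL z A -> bdry_minus g WL z B -> B = A *m CL)
  (hCR : forall z, jump_set g z -> forall A B : 'M[Cx R]_N,
     bdry_plus g WR z A -> bdry_minus g WR z B -> B = CR *m A)
  (PL PR : nat -> 'M[{poly Cx R}]_N)
  (C : nat -> 'M[Cx R]_N) (Cm1 : 'M[Cx R]_N)
  (C_unit : forall n, C n \in unitmx) (Cm1_unit : Cm1 \in unitmx)
  (PL_orth : left_orthogonal g W C PL) (PR_orth : right_orthogonal g W C PR)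
  (n : nat) :
  [/\ mx_holomorphic_on (~` loop_set g) (ZL g W WL WR C Cm1 PL n),
      mx_holomorphic_on (~` loop_set g) (ZR g W WL WR C Cm1 PR n),
      forall z, jump_set g z -> exists A B : 'M[Cx R]_(N + N),
        [/\ bdry_plus g (ZL g W WL WR C Cm1 PL n) z A,
            bdry_minus g (ZL g W WL WR C Cm1 PL n) z B &
            A = B *m block_mx CL CL 0 1%:M] &
      forall z, jump_set g z -> exists A B : 'M[Cx R]_(N + N),
        [/\ bdry_plus g (ZR g W WL WR C Cm1 PR n) z A,
            bdry_minus g (ZR g W WL WR C Cm1 PR n) z B &
            A = block_mx 1%:M 0 CR CR *m B]].
Proof.
have [gc gC1 _ _ _] := hg.
have [EL [ELu ELl WLE]] := left_solution_extension gc hL_entire WL_sol.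
have [ER [ERu ERl WRE]] := right_solution_extension gc hR_entire WR_sol.
have [WLD WLu _ _] := WL_sol; have [WRD WRu _ _] := WR_sol.
have mxD m p (F : Cx R -> 'M[Cx R]_(m, p)) :
    mx_holomorphic_on (~` loop_set g) F -> forall z, ~ loop_set g z -> mx_derivable F z.
  by move=> FD z zl i j; exact: FD.
have invD (F : Cx R -> 'M[Cx R]_N) : (forall z, ~ loop_set g z -> F z \in unitmx) ->
    mx_holomorphic_on (~` loop_set g) F ->
    forall z, ~ loop_set g z -> mx_derivable (fun w => invmx (F w)) z.
  move=> Fu FD z zl; apply: mx_derivable_inv; last exact: mxD.
  by apply: filterS (loop_compl_near gc zl) => w; exact: Fu.
have QLD k z : ~ loop_set g z -> mx_derivable (QL g W PL k) z.
  move=> zl; apply: (@Cauchy_mx_derivable R N g hg (fun w => mxeval (PL k) w *m W w) z zl) => i j.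
  exact: QL_integrable.
have QRD k z : ~ loop_set g z -> mx_derivable (QR g W PR k) z.
  move=> zl; apply: (@Cauchy_mx_derivable R N g hg (fun w => W w *m mxeval (PR k) w) z zl) => i j.
  exact: QR_integrable.
have FP (A : set (Cx R)) (z : Cx R) :
    Filter (within A (nbhs z)) by apply: within_filter; exact: nbhs_filter.
have bdry (F E : Cx R -> 'M[Cx R]_N) (A : set (Cx R)) z : (A `<=` ~` loop_set g) ->
    (forall w, ~ loop_set g w -> F w = E w) ->
    (forall i j, locally_lipschitz (fun w => E w i j) z) ->
    F @ within A (nbhs z) --> E z.
  move=> Al FE El; apply: (@cvg_within_eq _ _ A z E).
    by move=> w /Al wl; rewrite FE.
  apply/(cvg_mxP (FP _ _)) => i j; apply: cvg_within_filter.
  exact: (@locally_lipschitz_cvg R (fun w => E w i j) z (El i j)).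
have plusS : plus_side g `<=` ~` loop_set g by move=> z [].
have minusS : minus_side g `<=` ~` loop_set g by move=> z [].
have ELl' z i j : jump_set g z -> locally_lipschitz (fun w => EL w i j) z.
  by move=> /(jump_set_cexp hg W_bessel) [s <-]; exact: ELl.
have ERl' z i j : jump_set g z -> locally_lipschitz (fun w => ER w i j) z.
  by move=> /(jump_set_cexp hg W_bessel) [s <-]; exact: ERl.
(* The factorization applies to any boundary values from the + side, and those of W_L and W_R are
   the values of their extensions. *)
have WE z : jump_set g z -> W z = EL z *m ER z.
  move=> jz; apply: W_fact => //.
    exact: bdry plusS WLE (fun i j => ELl' z i j jz).
  exact: bdry plusS WRE (fun i j => ERl' z i j jz).
have QLj k z : jump_set g z ->
    has_jump g (QL g W PL k) z (mxeval (PL k) z *m (EL z *m ER z)).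
  move=> jz; apply: (Cauchy_mx_jump hg (E := fun w => mxeval (PL k) w *m (EL w *m ER w))).
  - by move=> i j; exact: QL_integrable.
  - exact: jz.
  - apply: locally_lipschitz_mulmx; first by move=> i j; exact: mxeval_lipschitz.
    by apply: locally_lipschitz_mulmx => i j; [exact: ELl'|exact: ERl'].
  - by move=> w jw; rewrite WE.
have QRj k z : jump_set g z ->
    has_jump g (QR g W PR k) z ((EL z *m ER z) *m mxeval (PR k) z).
  move=> jz; apply: (Cauchy_mx_jump hg (E := fun w => (EL w *m ER w) *m mxeval (PR k) w)).
  - by move=> i j; exact: QR_integrable.
  - exact: jz.
  - apply: locally_lipschitz_mulmx; last by move=> i j; exact: mxeval_lipschitz.
    by apply: locally_lipschitz_mulmx => i j; [exact: ELl'|exact: ERl'].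
  - by move=> w jw; rewrite WE.
(* The second row of Y_n^L and second column of Y_n^R, named so that n = 0 and n > 0 are treated
   together. *)
pose pL (w : Cx R) : 'M[Cx R]_N :=
  - (Defs.prev Cm1 C n *m Defs.prev 0 (fun m => mxeval (PL m) w) n).
pose qL (w : Cx R) : 'M[Cx R]_N :=
  - (Defs.prev Cm1 C n *m Defs.prev (- invmx Cm1) (fun m => QL g W PL m w) n).
pose pR (w : Cx R) : 'M[Cx R]_N :=
  - (Defs.prev 0 (fun m => mxeval (PR m) w) n *m Defs.prev Cm1 C n).
pose qR (w : Cx R) : 'M[Cx R]_N :=
  - (Defs.prev (- invmx Cm1) (fun m => QR g W PR m w) n *m Defs.prev Cm1 C n).
have pLD z : mx_derivable pL z.
  apply: mx_derivable_opp; apply: mx_derivable_mul; first exact: mx_derivable_const.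
  by case: (n) => [|m] /=; [exact: mx_derivable_const|exact: mxeval_derivable].
have pRD z : mx_derivable pR z.
  apply: mx_derivable_opp; apply: mx_derivable_mul; last exact: mx_derivable_const.
  by case: (n) => [|m] /=; [exact: mx_derivable_const|exact: mxeval_derivable].
have qLD z : ~ loop_set g z -> mx_derivable qL z.
  move=> zl; apply: mx_derivable_opp; apply: mx_derivable_mul.
    exact: mx_derivable_const.
  by case: (n) => [|m] /=; [exact: mx_derivable_const|exact: QLD].
have qRD z : ~ loop_set g z -> mx_derivable qR z.
  move=> zl; apply: mx_derivable_opp; apply: mx_derivable_mul.
    by case: (n) => [|m] /=; [exact: mx_derivable_const|exact: QRD].
  exact: mx_derivable_const.
have qLj z : jump_set g z -> has_jump g qL z (pL z *m (EL z *m ER z)).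
  move=> jz; rewrite /pL mulNmx -mulmxA; apply: has_jump_opp; apply: has_jump_mull.
  case: (n) => [|m] /=; last exact: QLj.
  by rewrite mul0mx; exact: has_jump_const.
have qRj z : jump_set g z -> has_jump g qR z ((EL z *m ER z) *m pR z).
  move=> jz; rewrite /pR mulmxN mulmxA; apply: has_jump_opp; apply: has_jump_mulr.
  case: (n) => [|m] /=; last exact: QRj.
  by rewrite mulmx0; exact: has_jump_const.
have cvgD (p : Cx R -> 'M[Cx R]_N) (A : set (Cx R)) z : mx_derivable p z ->
    p @ within A (nbhs z) --> p z.
  move=> pD; apply/(cvg_mxP (FP _ _)) => i j; apply: cvg_within_filter.
  exact: (@derivable_cvg R (fun w => p w i j) z (pD i j)).
have invc (F E : Cx R -> 'M[Cx R]_N) (A : set (Cx R)) z : A `<=` ~` loop_set g ->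
    (forall w, ~ loop_set g w -> F w \in unitmx) -> E z \in unitmx ->
    F @ within A (nbhs z) --> E z ->
    (fun w => invmx (F w)) @ within A (nbhs z) --> invmx (E z).
  move=> Al Fu Eu FE.
  (* [cvg_invmx] asks for invertibility at every point, while F is known to be invertible only off
     the loop; outside A it is replaced by the constant [E z], which leaves limits within A
     unchanged. *)
  pose F' w := if pselect (A w) then F w else E z.
  have F'F w : A w -> F w = F' w by rewrite /F'; case: pselect.
  have F'E := cvg_within_eq F'F FE.
  apply: (@cvg_within_eq _ _ A z (fun w => invmx (F' w))).
    by move=> w wA; rewrite (F'F w wA).
  apply: (@cvg_invmx _ _ _ (FP _ _)) => [w||]; [|exact: Eu|exact: F'E].
  by rewrite /F'; case: pselect => // wA; exact: Fu (Al w wA).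
split.
- move=> i j z zl; move: i j; apply: mx_derivable_mul; apply: mx_derivable_block.
  + exact: mxeval_derivable.
  + exact: QLD.
  + exact: pLD.
  + exact: qLD.
  + exact: mxD.
  + exact: mx_derivable_const.
  + exact: mx_derivable_const.
  + exact: (invD WR).
- move=> i j z zl; move: i j; apply: mx_derivable_mul; apply: mx_derivable_block.
  + exact: mxD.
  + exact: mx_derivable_const.
  + exact: mx_derivable_const.
  + exact: (invD WL).
  + exact: mxeval_derivable.
  + exact: pRD.
  + exact: QRD.
  + exact: qRD.
- move=> z jz.
  have [q1 [q1p q1m]] := QLj n z jz; have [q2 [q2p q2m]] := qLj z jz.
  have [s sz] := jump_set_cexp hg W_bessel jz.
  have aLu : EL z \in unitmx by rewrite -sz.
  have aRu : ER z \in unitmx by rewrite -sz.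
  have bL A : A `<=` ~` loop_set g -> WL @ within A (nbhs z) --> EL z.
    by move=> Al; exact: bdry Al WLE (fun i j => ELl' z i j jz).
  have bR A : A `<=` ~` loop_set g -> WR @ within A (nbhs z) --> ER z.
    by move=> Al; exact: bdry Al WRE (fun i j => ERl' z i j jz).
  (* [EL z] is the boundary value from both sides, so [EL z = EL z *m CL] with [EL z] invertible. *)
  have -> : CL = 1%:M.
    have := hCL z jz _ _ (bL _ plusS) (bL _ minusS) => e.
    by rewrite -[LHS]mul1mx -(mulVmx aLu) -mulmxA -e.
  pose D := block_mx (EL z) 0 0 (invmx (ER z)).
  have Dc A : A `<=` ~` loop_set g ->
      block_mx (WL w) 0 0 (invmx (WR w)) @[w --> within A (nbhs z)] --> D.
    move=> Al; have iA := invc WR ER A z Al WRu aRu (bR A Al).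
    apply: (@cvg_block_mx _ _ _ (FP _ _)); [exact: bL|exact: cvg_cst|exact: cvg_cst|].
    exact: iA.
  exists (block_mx (mxeval (PL n) z) q1 (pL z) q2 *m D).
  (* The minus value lowers only the second block column, by P W; the polynomial column and the
     weight factor are continuous at z. *)
  exists (block_mx (mxeval (PL n) z) (q1 - mxeval (PL n) z *m (EL z *m ER z))
    (pL z) (q2 - pL z *m (EL z *m ER z)) *m D).
  split.
  + apply: (@cvg_mulmx _ _ _ (FP _ _)); last exact: Dc.
    apply: (@cvg_block_mx _ _ _ (FP _ _)).
    * exact: cvgD (@mxeval_derivable _ _ _ _).
    * exact: q1p.
    * exact: cvgD (pLD z).
    * exact: q2p.
  + apply: (@cvg_mulmx _ _ _ (FP _ _)); last exact: Dc.
    apply: (@cvg_block_mx _ _ _ (FP _ _)).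
    * exact: cvgD (@mxeval_derivable _ _ _ _).
    * exact: q1m.
    * exact: cvgD (pLD z).
    * exact: q2m.
  + exact: jump_block_left.
- move=> z jz.
  have [q1 [q1p q1m]] := QRj n z jz; have [q2 [q2p q2m]] := qRj z jz.
  have [s sz] := jump_set_cexp hg W_bessel jz.
  have aLu : EL z \in unitmx by rewrite -sz.
  have aRu : ER z \in unitmx by rewrite -sz.
  have bL A : A `<=` ~` loop_set g -> WL @ within A (nbhs z) --> EL z.
    by move=> Al; exact: bdry Al WLE (fun i j => ELl' z i j jz).
  have bR A : A `<=` ~` loop_set g -> WR @ within A (nbhs z) --> ER z.
    by move=> Al; exact: bdry Al WRE (fun i j => ERl' z i j jz).
  (* As for [CL], with the constant matrix on the left: [ER z = CR *m ER z]. *)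
  have -> : CR = 1%:M.
    have := hCR z jz _ _ (bR _ plusS) (bR _ minusS) => e.
    by rewrite -[LHS]mulmx1 -(mulmxV aRu) mulmxA -e.
  pose D := block_mx (ER z) 0 0 (invmx (EL z)).
  have Dc A : A `<=` ~` loop_set g ->
      block_mx (WR w) 0 0 (invmx (WL w)) @[w --> within A (nbhs z)] --> D.
    move=> Al; have iA := invc WL EL A z Al WLu aLu (bL A Al).
    apply: (@cvg_block_mx _ _ _ (FP _ _)); [exact: bR|exact: cvg_cst|exact: cvg_cst|].
    exact: iA.
  exists (D *m block_mx (mxeval (PR n) z) (pR z) q1 q2).
  exists (D *m block_mx (mxeval (PR n) z) (pR z)
    (q1 - (EL z *m ER z) *m mxeval (PR n) z) (q2 - (EL z *m ER z) *m pR z)).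
  split.
  + apply: (@cvg_mulmx _ _ _ (FP _ _)); first exact: Dc.
    apply: (@cvg_block_mx _ _ _ (FP _ _)).
    * exact: cvgD (@mxeval_derivable _ _ _ _).
    * exact: cvgD (pRD z).
    * exact: q1p.
    * exact: q2p.
  + apply: (@cvg_mulmx _ _ _ (FP _ _)); first exact: Dc.
    apply: (@cvg_block_mx _ _ _ (FP _ _)).
    * exact: cvgD (@mxeval_derivable _ _ _ _).
    * exact: cvgD (pRD z).
    * exact: q1m.
    * exact: q2m.
  + exact: jump_block_right.
Qed.
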